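(* Let $\varphi(z)=1+B_1z+B_2z^2+B_3z^3+\cdots$ be a Ma–Minda function with $B_1^2\ge 2B_2$, let $f\in\mathcal{C}(\varphi)$, and put $$\sigma=\frac{2B_1(B_1^2+16B_1-2B_2)}{2B_1^4+B_1^3-B_1^2-2B_1B_2+B_1^2B_2-B_2^2}.$$ Then the following inequalities hold. (1) If $\sigma\notin[0,4]$, then $$\det T_{3,1}(f)\ge\min\left\{1-\frac{B_1^2}{36},\ 1-\frac{B_1^2}{2}+\frac{B_1^4}{18}+\frac{B_1^2B_2}{36}-\frac{B_2^2}{36}\right\}.$$ (2) If $\sigma=4$, then $$\det T_{3,1}(f)\ge 1-\frac{B_1^2}{2}+\frac{B_1^4}{18}+\frac{B_1^2B_2}{36}-\frac{B_2^2}{36}.$$ (3) If $\sigma\in(0,4)$, then $$\det T_{3,1}(f)\ge 1-\frac{B_1^3(B_1^3+4B_1^2+28B_1-8B_2)}{16(2B_1^4+B_1^3-B_1^2-2B_1B_2+B_1^2B_2-B_2^2)}.$$ The first two inequalities, (1) and (2), are sharp.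
   Context: $\mathbb{D}=\{z\in\mathbb{C}:|z|<1\}$. $\mathcal{A}$ is the class of analytic functions $f(z)=z+a_2z^2+a_3z^3+\cdots$ on $\mathbb{D}$. A Ma–Minda function is an analytic univalent function $\varphi$ on $\mathbb{D}$ with positive real part, $\varphi(0)=1$, $\varphi'(0)>0$, such that $\varphi(\mathbb{D})$ is starlike with respect to $1$ and symmetric about the real axis (so the coefficients $B_n$ are real and $B_1>0$). $\mathcal{C}(\varphi)=\{f\in\mathcal{A}: 1+zf''(z)/f'(z)\prec\varphi(z)\}$, where $\prec$ denotes subordination: $h\prec\varphi$ means $h=\varphi\circ\omega$ for some analytic $\omega:\mathbb{D}\to\mathbb{D}$ with $\omega(0)=0$. For $f(z)=z+a_2z^2+a_3z^3+\cdots$, the third order Hermitian–Toeplitz determinant is $$\det T_{3,1}(f)=\begin{vmatrix}1&a_2&a_3\\ \bar a_2&1&a_2\\ \bar a_3&\bar a_2&1\end{vmatrix}=2\,\mathrm{Re}(a_2^2\bar a_3)-2|a_2|^2-|a_3|^2+1.$$ An inequality is sharp if, for each $\varphi$ satisfying its hypotheses, equality is attained by some function in the class. *)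

(* Defs.v *)
(* Stdlib reals with Coquelicot's complex numbers [C]. *)
From Stdlib Require Import Reals Lra.
From Coquelicot Require Import Coquelicot.
Open Scope R_scope.

Definition in_disc (z : C) : Prop := Cmod z < 1.

Definition expansion (f : C -> C) (a : nat -> C) : Prop :=
  forall z : C, in_disc z -> is_pseries (K := C_AbsRing) (V := C_NormedModule) a z (f z).

(* Analytic means representable by a power series; on a disc, the Taylor series at
   the centre converges on the whole disc.  Functions on the disc are represented by total functions [C -> C] whose values
   outside the disc are irrelevant. *)
Definition analytic_on_disc (f : C -> C) : Prop :=
  exists a : nat -> C, expansion f a.

Definition class_A (f : C -> C) : Prop :=
  exists a : nat -> C, expansion f a /\ a 0%nat = RtoC 0 /\ a 1%nat = RtoC 1.

Definition univalent (phi : C -> C) : Prop :=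
  forall z w : C, in_disc z -> in_disc w -> phi z = phi w -> z = w.

Definition image_disc (phi : C -> C) (u : C) : Prop :=
  exists z : C, in_disc z /\ phi z = u.

Definition starlike_wrt (S : C -> Prop) (c : C) : Prop :=
  forall (u : C) (t : R), S u -> 0 <= t <= 1 ->
    S (c + RtoC t * (u - c))%C.

Definition symmetric_real_axis (S : C -> Prop) : Prop :=
  forall u : C, S u -> S (Cconj u).

Record ma_minda (phi : C -> C) : Prop := {
  mm_analytic : analytic_on_disc phi;
  mm_univalent : univalent phi;
  mm_Re_pos : forall z : C, in_disc z -> 0 < Re (phi z);
  mm_at0 : phi (RtoC 0) = RtoC 1;
  mm_deriv0 : Im (C_derive phi (RtoC 0)) = 0 /\ 0 < Re (C_derive phi (RtoC 0));
  mm_starlike : starlike_wrt (image_disc phi) (RtoC 1);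
  mm_symmetric : symmetric_real_axis (image_disc phi)
}.

Definition subordinate (h phi : C -> C) : Prop :=
  exists w : C -> C,
    analytic_on_disc w /\
    (forall z : C, in_disc z -> in_disc (w z)) /\
    w (RtoC 0) = RtoC 0 /\
    (forall z : C, in_disc z -> h z = phi (w z)).

(* Division in [C] is total, so the condition that [1 + z f'' / f'] is defined on
   the whole disc has to be stated: at a zero of [f'] it would have a pole. *)
Definition class_C (phi f : C -> C) : Prop :=
  class_A f /\
  (forall z : C, in_disc z -> C_derive f z <> RtoC 0) /\
  subordinate
    (fun z => (RtoC 1 + z * C_derive (C_derive f) z / C_derive f z)%C) phi.

(* Rows and columns are indexed from 0: the entry in row [i], column [j] is
   [a_(1+j-i)] on and above the diagonal, and the conjugate of [a_(1+i-j)] below. *)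
Definition hermitian_toeplitz (a : nat -> C) (i j : nat) : C :=
  if (i <=? j)%nat then a (1 + (j - i))%nat else Cconj (a (1 + (i - j))%nat).

Definition det3 (M : nat -> nat -> C) : C :=
  ( M 0%nat 0%nat * (M 1%nat 1%nat * M 2%nat 2%nat - M 1%nat 2%nat * M 2%nat 1%nat)
  - M 0%nat 1%nat * (M 1%nat 0%nat * M 2%nat 2%nat - M 1%nat 2%nat * M 2%nat 0%nat)
  + M 0%nat 2%nat * (M 1%nat 0%nat * M 2%nat 1%nat - M 1%nat 1%nat * M 2%nat 0%nat))%C.

(* The determinant is real (lemma below), which justifies taking the real part. *)
Definition det_T31 (a : nat -> C) : R := Re (det3 (hermitian_toeplitz a)).

Lemma det3_hermitian_toeplitzE (a : nat -> C) : a 1%nat = RtoC 1 ->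
  det3 (hermitian_toeplitz a) =
  RtoC (2 * Re (a 2%nat ^ 2 * Cconj (a 3%nat))%C
        - 2 * Cmod (a 2%nat) ^ 2 - Cmod (a 3%nat) ^ 2 + 1).
Proof.
intros a1; unfold det3, hermitian_toeplitz; simpl; rewrite a1.
assert (Cmod2 : forall z : C, Cmod z * (Cmod z * 1) = fst z * fst z + snd z * snd z).
{ intros z; rewrite Rmult_1_r; unfold Cmod.
  rewrite sqrt_sqrt; [ring | apply Rplus_le_le_0_compat; apply pow2_ge_0]. }
rewrite !Cmod2.
destruct (a 2%nat) as [p q], (a 3%nat) as [r s].
unfold RtoC, Re, Cplus, Cminus, Cmult, Copp, Cconj; simpl.
f_equal; ring.
Qed.

(* Main.v *)
Require Import Defs.
From Stdlib Require Import Reals Lra Lia ClassicalEpsilon.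
From Coquelicot Require Import Coquelicot.
Open Scope R_scope.

(** Let [1 + z f'' / f' = phi o w] with [w = c1 z + c2 z^2 + ...] a self-map of the disc.
    Comparing coefficients ([convex_coef]) gives [2 a2 = B1 c1] and
    [6 a3 = B1 c2 + (B2 + B1^2) c1^2].  The determinant is
    [1 - 2 |a2|^2 + |a2|^4 - |a3 - a2^2|^2] ([det_T31_squares]), and
    [6 (a3 - a2^2) = B1 c2 - (B1^2 / 2 - B2) c1^2], where [B1^2 / 2 - B2 >= 0].  Since
    [|c2| <= 1 - |c1|^2] ([Schwarz_coef_le]), the determinant is at least a quadratic
    polynomial in [t = |c1|^2] ([det_T31_ge]), and the three bounds are the minima of this
    polynomial over [0 <= t <= 1] according to the position of its vertex
    ([det_profile_min]).

    The estimate on [c2] comes from an average over a circle.  For a complex number [b], the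
    mean value of [w (1 + b z)^2 / z^2] over the unit circle is [c2 + 2 c1 b], and
    [|1 + b z|^2] has mean value [1 + |b|^2]; as [|w| <= 1], this gives
    [|c2 + 2 c1 b| <= 1 + |b|^2].  The choice of [b] with [|b| = |c1|] and with [c1 b] in the
    direction of [c2] yields the estimate.  Averages over roots of unity of a truncated
    series replace the integral.

    For sharpness, [w = z] and [w = z^2] correspond to [t = 1] and [t = 0] and attain the
    values of the quadratic polynomial there.  A function [f] with
    [1 + z f'' / f' = phi o w] is found by solving [g' = Q g], [g(0) = 1], with
    [Q = (phi o w - 1) / z] and [g = f'], as a power series ([linear_ode]).  The solution has
    no zero, because the solution for [- Q] is its inverse ([linear_ode_neq_0]). *)

(** * Complex series *)

Notation Csum := (sum_n (G := C_AbelianMonoid)).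
Notation is_Cseries := (@is_series C_AbsRing C_NormedModule).

Lemma Re_sum_n (u : nat -> C) (n : nat) :
  Re (Csum u n) = sum_n (fun k => Re (u k)) n.
Proof.
induction n as [|n IH]; [now rewrite !sum_O|].
rewrite !sum_Sn, <- IH; reflexivity.
Qed.

Lemma Im_sum_n (u : nat -> C) (n : nat) :
  Im (Csum u n) = sum_n (fun k => Im (u k)) n.
Proof.
induction n as [|n IH]; [now rewrite !sum_O|].
rewrite !sum_Sn, <- IH; reflexivity.
Qed.

Lemma is_Cseries_components (u : nat -> C) (l : C) :
  is_Cseries u l <->
  is_series (fun n => Re (u n)) (Re l) /\ is_series (fun n => Im (u n)) (Im l).
Proof.
split.
- intros H; split.
  + apply filterlim_ext with (fun n => Re (Csum u n)).
    { intros n; apply Re_sum_n. }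
    apply filterlim_comp with (1 := H).
    intros P [e He]; exists e; intros y [Hy _]; apply He, Hy.
  + apply filterlim_ext with (fun n => Im (Csum u n)).
    { intros n; apply Im_sum_n. }
    apply filterlim_comp with (1 := H).
    intros P [e He]; exists e; intros y [_ Hy]; apply He, Hy.
- intros [Hre Him] P [e He].
  assert (H1 := Hre _ (locally_ball (Re l) e)).
  assert (H2 := Him _ (locally_ball (Im l) e)).
  unfold filtermap in *.
  apply filter_imp with (2 := filter_and _ _ H1 H2).
  intros n [Bre Bim]; apply He; split.
  + change (ball (Re l) e (Re (Csum u n))).
    rewrite Re_sum_n; exact Bre.
  + change (ball (Im l) e (Im (Csum u n))).
    rewrite Im_sum_n; exact Bim.
Qed.

Lemma C_eq_components (x y : C) : Re x = Re y -> Im x = Im y -> x = y.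
Proof. destruct x, y; simpl; now intros -> ->. Qed.

Lemma is_Cseries_unique (u : nat -> C) (l l' : C) :
  is_Cseries u l -> is_Cseries u l' -> l = l'.
Proof.
rewrite !is_Cseries_components; intros [H1 H2] [H3 H4]; apply C_eq_components.
- now rewrite <- (is_series_unique _ _ H1), <- (is_series_unique _ _ H3).
- now rewrite <- (is_series_unique _ _ H2), <- (is_series_unique _ _ H4).
Qed.

Lemma im_le_Cmod (z : C) : Rabs (Im z) <= Cmod z.
Proof. eapply Rle_trans, Rmax_Cmod; apply Rmax_r. Qed.

Lemma ex_Cseries_Cmod (u : nat -> C) :
  ex_series (fun n => Cmod (u n)) -> exists l, is_Cseries u l.
Proof.
intros H.
assert (Hre : ex_series (fun n => Re (u n))).
{ apply (ex_series_le (V := R_CompleteNormedModule)) with (2 := H); intros n; apply re_le_Cmod. }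
assert (Him : ex_series (fun n => Im (u n))).
{ apply (ex_series_le (V := R_CompleteNormedModule)) with (2 := H); intros n; apply im_le_Cmod. }
exists (Series (fun n => Re (u n)), Series (fun n => Im (u n))).
apply is_Cseries_components; split; now apply Series_correct.
Qed.

Lemma Cmod_sum_n_le (u : nat -> C) (n : nat) :
  Cmod (Csum u n) <= sum_n (fun k => Cmod (u k)) n.
Proof. apply (norm_sum_n_m (V := C_NormedModule)). Qed.

Lemma sum_n_le_series (v : nat -> R) (s : R) (n : nat) :
  (forall k, 0 <= v k) -> is_series v s -> sum_n v n <= s.
Proof.
intros Hv Hs.
apply (is_lim_seq_incr_compare (sum_n v) s); [exact Hs|].
intros k; rewrite sum_Sn; unfold plus; simpl; specialize (Hv (S k)); lra.
Qed.

Lemma Cmod_series_le (u : nat -> C) (v : nat -> R) (l : C) (s : R) :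
  (forall n, Cmod (u n) <= v n) -> is_Cseries u l -> is_series v s -> Cmod l <= s.
Proof.
intros Huv Hl Hs.
assert (Hlim : is_lim_seq (fun n => Cmod (Csum u n)) (Cmod l)).
{ apply (filterlim_comp _ _ _ _ (@norm C_AbsRing C_NormedModule) _ _ _ Hl).
  apply (filterlim_norm (V := C_NormedModule)). }
apply (is_lim_seq_le _ _ (Cmod l) s) with (2 := Hlim) (3 := Hs).
intros n; eapply Rle_trans; [apply Cmod_sum_n_le|].
now apply sum_n_m_le.
Qed.

(** The real Cauchy product theorem applies to the four products of real and imaginary
    parts. *)
Lemma is_Cseries_Cauchy_product (u v : nat -> C) (lu lv : C) :
  is_Cseries u lu -> is_Cseries v lv ->
  ex_series (fun n => Cmod (u n)) -> ex_series (fun n => Cmod (v n)) ->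
  is_Cseries
    (fun n => Csum (fun k => (u k * v (n - k)%nat)%C) n) (lu * lv)%C.
Proof.
intros Hu Hv Au Av.
apply is_Cseries_components in Hu; destruct Hu as [Hur Hui].
apply is_Cseries_components in Hv; destruct Hv as [Hvr Hvi].
assert (dom : forall (w : nat -> C) (p : C -> R), (forall z, Rabs (p z) <= Cmod z) ->
  ex_series (fun n => Cmod (w n)) -> ex_series (fun n => Rabs (p (w n)))).
{ intros w p Hp Hw; apply (ex_series_le (V := R_CompleteNormedModule)) with (2 := Hw).
  intros n; unfold norm; simpl; unfold abs; simpl; rewrite Rabs_Rabsolu; apply Hp. }
assert (Aur := dom u Re re_le_Cmod Au); assert (Aui := dom u Im im_le_Cmod Au).
assert (Avr := dom v Re re_le_Cmod Av); assert (Avi := dom v Im im_le_Cmod Av).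
assert (rr := is_series_mult _ _ _ _ Hur Hvr Aur Avr).
assert (ii := is_series_mult _ _ _ _ Hui Hvi Aui Avi).
assert (ri := is_series_mult _ _ _ _ Hur Hvi Aur Avi).
assert (ir := is_series_mult _ _ _ _ Hui Hvr Aui Avr).
apply is_Cseries_components; split.
- apply is_series_ext with (2 := is_series_minus _ _ _ _ rr ii).
  intros n; rewrite Re_sum_n, <- !sum_n_Reals.
  assert (sub : forall (a b : nat -> R) m,
    plus (sum_n a m) (opp (sum_n b m)) = sum_n (fun k => a k - b k) m).
  { intros a b m; induction m as [|m IH]; [now rewrite !sum_O|].
    rewrite !sum_Sn, <- IH; unfold plus, opp; simpl; ring. }
  rewrite sub; apply sum_n_ext; reflexivity.
- apply is_series_ext with (2 := is_series_plus _ _ _ _ ri ir).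
  intros n; rewrite Im_sum_n, <- !sum_n_Reals.
  rewrite <- (sum_n_plus (G := R_AbelianMonoid)); apply sum_n_ext; reflexivity.
Qed.

(** * Power series on the unit disc *)

Lemma expansion_series (f : C -> C) (a : nat -> C) :
  expansion f a <-> forall z, in_disc z -> is_Cseries (fun n => (a n * z ^ n)%C) (f z).
Proof.
assert (E : forall (z : C) n, scal (V := C_NormedModule) (pow_n (K := C_AbsRing) z n) (a n) = (a n * z ^ n)%C).
{ intros z n; change (pow_n (K := C_AbsRing) z n * a n = a n * z ^ n)%C.
  apply Cmult_comm. }
split; intros H z Hz; apply is_series_ext with (2 := H z Hz); intros n; now rewrite E.
Qed.

(** Cauchy's estimate for the coefficients, on every circle inside the disc: it is both
    necessary and sufficient for convergence, and it is easy to transport through the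
    operations on coefficients. *)
Definition tame (a : nat -> C) : Prop :=
  forall r, 0 <= r < 1 -> exists K, forall n, Cmod (a n) * r ^ n <= K.

Lemma expansion_tame (f : C -> C) (a : nat -> C) : expansion f a -> tame a.
Proof.
rewrite expansion_series; intros H r Hr.
assert (Hz : in_disc (RtoC r)) by (red; rewrite Cmod_R, Rabs_pos_eq; lra).
destruct (filterlim_bounded (V := C_NormedModule) (Csum (fun n => (a n * r ^ n)%C)))
  as [M HM]; [exists (f r); apply (H _ Hz)|].
change (forall n, Cmod (Csum (fun n => (a n * r ^ n)%C) n) <= M) in HM.
exists (M + M); intros n.
replace (Cmod (a n) * r ^ n) with (Cmod (a n * r ^ n)%C)
  by (rewrite Cmod_mult, Cmod_pow, Cmod_R, Rabs_pos_eq; lra).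
destruct n as [|n].
- specialize (HM 0%nat); rewrite sum_O in HM.
  assert (H0 := Cmod_ge_0 (a 0%nat * r ^ 0)%C); lra.
- assert (H1 := HM (S n)); rewrite sum_Sn in H1; assert (H2 := HM n).
  set (s := Csum _ n) in *; set (t := (a (S n) * r ^ S n)%C) in *.
  change (Cmod (s + t) <= M) in H1.
  replace t with ((s + t) + - s)%C by ring.
  eapply Rle_trans; [apply Cmod_triangle|]; rewrite Cmod_opp; lra.
Qed.

Lemma tame_summable (a : nat -> C) (r : R) :
  tame a -> 0 <= r < 1 -> ex_series (fun n => Cmod (a n) * r ^ n).
Proof.
intros Ha Hr; set (p := (1 + r) / 2).
destruct (Ha p) as [K HK]; [unfold p; lra|].
assert (Hp : 0 < p) by (unfold p; lra).
assert (Hq : 0 <= r / p < 1).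
{ split; [apply Rdiv_le_0_compat; lra|apply Rlt_div_l; unfold p; lra]. }
apply (ex_series_le (V := R_CompleteNormedModule)) with (b := fun n => K * (r / p) ^ n).
- intros n; change (Rabs (Cmod (a n) * r ^ n) <= K * (r / p) ^ n).
  rewrite Rabs_pos_eq; [|apply Rmult_le_pos; [apply Cmod_ge_0|apply pow_le; lra]].
  replace (r ^ n) with (p ^ n * (r / p) ^ n)
    by (rewrite <- Rpow_mult_distr; f_equal; field; lra).
  rewrite <- Rmult_assoc; apply Rmult_le_compat_r; [now apply pow_le|apply HK].
- apply (ex_series_scal_l (V := R_NormedModule) K).
  apply ex_series_geom; rewrite Rabs_pos_eq; lra.
Qed.

Lemma tame_summable_disc (a : nat -> C) (z : C) :
  tame a -> in_disc z -> ex_series (fun n => Cmod (a n * z ^ n)%C).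
Proof.
intros Ha Hz; eapply ex_series_ext; [|apply (tame_summable a (Cmod z) Ha)].
- intros n; now rewrite Cmod_mult, Cmod_pow.
- split; [apply Cmod_ge_0|exact Hz].
Qed.

Lemma tame_expansion (a : nat -> C) : tame a -> exists f, expansion f a.
Proof.
intros Ha.
exists (fun z => epsilon (inhabits (RtoC 0)) (fun l => is_Cseries (fun n => (a n * z ^ n)%C) l)).
apply expansion_series; intros z Hz.
apply (epsilon_spec (inhabits (RtoC 0)) (fun l => is_Cseries (fun n => (a n * z ^ n)%C) l)).
now apply ex_Cseries_Cmod, tame_summable_disc.
Qed.

Definition derive_coef (a : nat -> C) (n : nat) : C := (RtoC (INR (S n)) * a (S n))%C.

(** [(n + 1) q ^ n] is at most the geometric sum [1 + q + ... + q ^ n]. *)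
Lemma linear_geometric_le (q : R) (n : nat) :
  0 <= q < 1 -> INR (S n) * q ^ n * (1 - q) <= 1 - q ^ S n.
Proof.
intros Hq; induction n as [|n IH]; [simpl; lra|].
rewrite S_INR; simpl pow in *; set (p := q ^ n) in *.
assert (Hp : 0 <= p <= 1).
{ split; [now apply pow_le|]; unfold p; rewrite <- (pow1 n); apply pow_incr; lra. }
assert (q * (INR (S n) * p * (1 - q)) <= q * (1 - q * p)) by (apply Rmult_le_compat_l; lra).
assert (q * p <= 1) by nra.
nra.
Qed.

Lemma tame_derive_coef (a : nat -> C) : tame a -> tame (derive_coef a).
Proof.
intros Ha r Hr; set (p := (1 + r) / 2).
destruct (Ha p) as [K HK]; [unfold p; lra|].
assert (Hp : 0 < p) by (unfold p; lra).
assert (Hq : 0 <= r / p < 1).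
{ split; [apply Rdiv_le_0_compat; lra|apply Rlt_div_l; unfold p; lra]. }
exists (/ (1 - r / p) * (K / p)); intros n.
unfold derive_coef; rewrite Cmod_mult, Cmod_R, Rabs_pos_eq by apply pos_INR.
replace (r ^ n) with (p ^ n * (r / p) ^ n)
    by (rewrite <- Rpow_mult_distr; f_equal; field; lra).
replace (INR (S n) * Cmod (a (S n)) * (p ^ n * (r / p) ^ n)) with
  ((INR (S n) * (r / p) ^ n) * (Cmod (a (S n)) * p ^ S n / p)) by (simpl pow; field; lra).
assert (Hn := linear_geometric_le _ n Hq).
assert (0 <= (r / p) ^ S n) by (apply pow_le; lra).
apply Rmult_le_compat.
- apply Rmult_le_pos; [apply pos_INR|apply pow_le; lra].
- apply Rdiv_le_0_compat; [|lra]; apply Rmult_le_pos; [apply Cmod_ge_0|apply pow_le; lra].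
- apply Rmult_le_reg_r with (1 - r / p); [lra|]; rewrite Rinv_l; lra.
- apply Rmult_le_compat_r; [left; now apply Rinv_0_lt_compat|apply HK].
Qed.

Lemma tame_shift (a : nat -> C) : tame a -> tame (fun n => a (S n)).
Proof.
intros Ha r Hr; destruct (tame_derive_coef a Ha r Hr) as [K HK]; exists K; intros n.
eapply Rle_trans; [|apply (HK n)].
unfold derive_coef; rewrite Cmod_mult, Cmod_R, Rabs_pos_eq by apply pos_INR.
apply Rmult_le_compat_r; [apply pow_le; lra|].
rewrite S_INR; assert (H := pos_INR n); assert (H0 := Cmod_ge_0 (a (S n))); nra.
Qed.

Lemma is_Cseries_shift (a : nat -> C) (z l : C) :
  is_Cseries (fun n => (a (S n) * z ^ n)%C) l ->
  is_Cseries (fun n => (a n * z ^ n)%C) (a 0%nat + z * l)%C.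
Proof.
intros H; apply (is_series_decr_1 (V := C_NormedModule)).
apply is_series_ext with (fun n => scal (V := C_NormedModule) z (a (S n) * z ^ n)%C).
- intros n; change (z * (a (S n) * z ^ n) = a (S n) * z ^ S n)%C; rewrite Cpow_S; ring.
- replace (plus _ _) with (scal (V := C_NormedModule) z l).
  + now apply (is_series_scal_l (V := C_NormedModule)).
  + change (z * l = (a 0%nat + z * l) + - (a 0%nat * z ^ 0))%C.
    change (z ^ 0)%C with (RtoC 1); ring.
Qed.

Lemma expansion_shift (f g : C -> C) (a : nat -> C) :
  expansion f a -> expansion g (fun n => a (S n)) ->
  forall z, in_disc z -> f z = (a 0%nat + z * g z)%C.
Proof.
rewrite !expansion_series; intros Hf Hg z Hz.
apply is_Cseries_unique with (1 := Hf z Hz), is_Cseries_shift, Hg, Hz.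
Qed.

(** The Taylor remainder of a monomial at [z] satisfies the recurrence
    [T (n + 2) = y * T (n + 1) + (n + 1) * z ^ n * (y - z) ^ 2], which bounds it by the
    coefficients of the second derivative. *)
Lemma monomial_Taylor_le (rho : R) (y z : C) (n : nat) :
  Cmod y <= rho -> Cmod z <= rho ->
  Cmod (y ^ S (S n) - z ^ S (S n) - RtoC (INR (S (S n))) * z ^ S n * (y - z))
  <= INR (S n) * INR (S (S n)) * rho ^ n * Cmod (y - z) ^ 2.
Proof.
intros Hy Hz.
assert (Hd := Cmod_ge_0 (y - z)); assert (Hy0 := Cmod_ge_0 y).
induction n as [|n IH].
- replace (y ^ 2 - z ^ 2 - RtoC (INR 2) * z ^ 1 * (y - z))%C with ((y - z) ^ 2)%C.
  + rewrite Cmod_pow; simpl; nra.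
  + simpl; rewrite RtoC_plus; ring.
- replace (y ^ S (S (S n)) - z ^ S (S (S n)) - RtoC (INR (S (S (S n)))) * z ^ S (S n) * (y - z))%C
    with (y * (y ^ S (S n) - z ^ S (S n) - RtoC (INR (S (S n))) * z ^ S n * (y - z))
          + RtoC (INR (S (S n))) * z ^ S n * (y - z) ^ 2)%C.
  2: { rewrite (S_INR (S (S n))), RtoC_plus, !Cpow_S; ring. }
  eapply Rle_trans; [apply Cmod_triangle|].
  rewrite !Cmod_mult, !Cmod_pow, Cmod_R, Rabs_pos_eq by apply pos_INR.
  assert (P : Cmod z ^ S n <= rho ^ S n) by (apply pow_incr; split; [apply Cmod_ge_0|exact Hz]).
  assert (P0 : 0 <= rho ^ n) by (apply pow_le; lra).
  rewrite !S_INR in *; assert (Hn := pos_INR n); simpl in *.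
  set (d := Cmod (y - z)) in *; set (N := INR n) in *; set (p := rho ^ n) in *.
  assert (D : 0 <= d * (d * 1)) by nra.
  set (dd := d * (d * 1)) in *.
  assert (Cmod y * Cmod (y * (y * y ^ n) - z * (z * z ^ n) - RtoC (N + 1 + 1) * (z * z ^ n) * (y - z))
    <= rho * ((N + 1) * (N + 1 + 1) * p * dd))
    by (apply Rmult_le_compat; auto using Cmod_ge_0).
  assert ((N + 1 + 1) * (Cmod z * Cmod z ^ n) * dd <= (N + 1 + 1) * (rho * p) * dd)
    by (apply Rmult_le_compat_r; [|apply Rmult_le_compat_l]; lra).
  assert (0 <= (N + 1 + 1) * (rho * p) * dd) by (repeat apply Rmult_le_pos; lra).
  lra.
Qed.

Lemma expansion_Taylor_le (f g : C -> C) (a : nat -> C) (rho : R) :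
  expansion f a -> expansion g (derive_coef a) -> 0 <= rho < 1 ->
  exists S, forall y z, Cmod y <= rho -> Cmod z <= rho ->
    Cmod (f y - f z - g z * (y - z)) <= S * Cmod (y - z) ^ 2.
Proof.
intros Hf Hg Hrho; assert (Ha := expansion_tame _ _ Hf).
set (b := derive_coef (derive_coef a)).
assert (Hb : tame b) by now apply tame_derive_coef, tame_derive_coef.
destruct (tame_summable b rho Hb Hrho) as [s Hs].
exists s; intros y z Hy Hz.
assert (Dy : in_disc y) by (red; lra); assert (Dz : in_disc z) by (red; lra).
rewrite expansion_series in Hf, Hg.
apply Cmod_series_le with
  (u := fun n => (a (S (S n)) * (y ^ S (S n) - z ^ S (S n)
           - RtoC (INR (S (S n))) * z ^ S n * (y - z)))%C)
  (v := fun n => Cmod (y - z) ^ 2 * (Cmod (b n) * rho ^ n)).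
- intros n; rewrite Cmod_mult.
  unfold b, derive_coef; rewrite !Cmod_mult, !Cmod_R, !Rabs_pos_eq by apply pos_INR.
  assert (H := monomial_Taylor_le rho y z n Hy Hz).
  apply Rmult_le_compat_l with (r := Cmod (a (S (S n)))) in H; [|apply Cmod_ge_0].
  lra.
- assert (G0 : is_Cseries (fun n => match n with 0 => RtoC 0 | S m => derive_coef a m * z ^ m * (y - z) end)%C
    (g z * (y - z))%C).
  { apply (is_series_decr_1 (V := C_NormedModule)).
    replace (plus _ _) with (scal (V := C_NormedModule) (y - z)%C (g z)).
    - apply is_series_ext with (2 := is_series_scal_l (V := C_NormedModule) _ _ _ (Hg z Dz)).
      intros n; change ((y - z) * (derive_coef a n * z ^ n) = derive_coef a n * z ^ n * (y - z))%C; ring.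
    - change ((y - z) * g z = g z * (y - z) + - RtoC 0)%C; ring. }
  assert (F := is_series_minus (V := C_NormedModule) _ _ _ _
    (is_series_minus (V := C_NormedModule) _ _ _ _ (Hf y Dy) (Hf z Dz)) G0).
  change (is_Cseries (fun n => (a n * y ^ n + - (a n * z ^ n) +
    - match n with 0 => RtoC 0 | S m => derive_coef a m * z ^ m * (y - z) end)%C)
    (f y + - f z + - (g z * (y - z)))%C) in F.
  set (u := fun n => (a n * (y ^ n - z ^ n - RtoC (INR n) * z ^ pred n * (y - z)))%C).
  assert (U : is_Cseries u (f y - f z - g z * (y - z))%C).
  { apply is_series_ext with (2 := F); unfold u, derive_coef.
    intros [|n]; [|rewrite S_INR]; simpl; rewrite ?RtoC_plus; ring. }
  apply (is_series_incr_1 (V := C_NormedModule) (fun n => u (S n))).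
  apply (is_series_incr_1 (V := C_NormedModule) u).
  replace (plus _ _) with (f y - f z - g z * (y - z))%C; [exact U|].
  change (f y - f z - g z * (y - z) = f y - f z - g z * (y - z) + u 1%nat + u 0%nat)%C.
  unfold u; simpl; ring.
- rewrite Rmult_comm; apply (is_series_scal_l (V := R_NormedModule)), Hs.
Qed.

Lemma expansion_is_derive (f g : C -> C) (a : nat -> C) (z : C) :
  expansion f a -> expansion g (derive_coef a) -> in_disc z ->
  is_derive (K := C_AbsRing) (V := C_NormedModule) f z (g z).
Proof.
intros Hf Hg Hz; unfold in_disc in Hz.
set (rho := (1 + Cmod z) / 2); assert (Hz0 := Cmod_ge_0 z).
destruct (expansion_Taylor_le f g a rho Hf Hg) as [S HS]; [unfold rho; lra|].
split; [apply is_linear_scal_l|].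
intros x Hx.
assert (E : z = x).
{ apply (is_filter_lim_locally_unique (V := AbsRing_NormedModule C_AbsRing)), Hx. }
subst x; intros [eps Heps]; simpl.
set (d := Rmin ((1 - Cmod z) / 2) (eps / (Rabs S + 1))).
assert (Hd : 0 < d).
{ apply Rmin_pos; [lra|]; apply Rdiv_lt_0_compat; [lra|]; assert (H := Rabs_pos S); lra. }
exists (mkposreal d Hd); intros y Hy.
change (Cmod (y - z) < d) in Hy.
change (Cmod (f y - f z - (y - z) * g z) <= eps * Cmod (y - z)).
assert (H1 := Rmin_l ((1 - Cmod z) / 2) (eps / (Rabs S + 1))).
assert (H2 := Rmin_r ((1 - Cmod z) / 2) (eps / (Rabs S + 1))).
fold d in H1, H2.
rewrite (Cmult_comm (y - z)).
eapply Rle_trans; [apply HS|].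
- replace y with ((y - z) + z)%C by ring.
  eapply Rle_trans; [apply Cmod_triangle|]; unfold rho; lra.
- unfold rho; lra.
- simpl; rewrite Rmult_1_r, <- Rmult_assoc.
  apply Rmult_le_compat_r; [apply Cmod_ge_0|].
  assert (A := Rabs_pos S); assert (A' := Rle_abs S); assert (D := Cmod_ge_0 (y - z)).
  apply Rle_trans with ((Rabs S + 1) * d).
  + apply Rle_trans with ((Rabs S + 1) * Cmod (y - z)); [|apply Rmult_le_compat_l; lra].
    apply Rmult_le_compat_r; lra.
  + apply Rmult_le_compat_l with (r := Rabs S + 1) in H2; [|lra].
    replace ((Rabs S + 1) * (eps / (Rabs S + 1))) with eps in H2 by (field; lra); lra.
Qed.

Lemma expansion_C_derive (f : C -> C) (a : nat -> C) :
  expansion f a -> expansion (C_derive f) (derive_coef a).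
Proof.
intros Hf.
destruct (tame_expansion (derive_coef a)) as [g Hg];
  [now apply tame_derive_coef, (expansion_tame f)|].
intros z Hz; rewrite (is_C_derive_unique f z (g z)); [now apply Hg|].
now apply (expansion_is_derive f g a).
Qed.

(** * The linear equation g' = Q g *)

Definition Cauchy_coef (a b : nat -> C) (n : nat) : C :=
  Csum (fun k => (a k * b (n - k)%nat)%C) n.

Lemma expansion_mult (f g : C -> C) (a b : nat -> C) :
  expansion f a -> expansion g b ->
  expansion (fun z => (f z * g z)%C) (Cauchy_coef a b).
Proof.
intros Hf Hg.
assert (Ta := expansion_tame _ _ Hf); assert (Tb := expansion_tame _ _ Hg).
rewrite expansion_series in Hf, Hg |- *; intros z Hz.
apply is_series_ext with (2 := is_Cseries_Cauchy_product _ _ _ _ (Hf z Hz) (Hg z Hz)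
  (tame_summable_disc a z Ta Hz) (tame_summable_disc b z Tb Hz)).
intros n; unfold Cauchy_coef.
rewrite Cmult_comm, <- (sum_n_mult_l (K := C_Ring)).
apply sum_n_ext_loc; intros k Hk.
change (a k * z ^ k * (b (n - k)%nat * z ^ (n - k)) = z ^ n * (a k * b (n - k)%nat))%C.
replace (z ^ n)%C with (z ^ k * z ^ (n - k))%C; [ring|].
rewrite <- Cpow_add_r; f_equal; lia.
Qed.

Lemma is_derive_Cmult (f g : C -> C) (z df dg : C) :
  is_derive (K := C_AbsRing) (V := C_NormedModule) f z df ->
  is_derive (K := C_AbsRing) (V := C_NormedModule) g z dg ->
  is_derive (K := C_AbsRing) (V := C_NormedModule) (fun x => f x * g x)%C z
    (df * g z + f z * dg)%C.
Proof.
intros Hf Hg.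
assert (H : is_derive (K := C_AbsRing) (V := AbsRing_NormedModule C_AbsRing)
  (fun x => f x * g x)%C z (df * g z + f z * dg)%C).
{ (* The two normed module structures on the complex numbers have the same norm. *)
  apply (is_derive_mult (K := C_AbsRing) f g z df dg); [| |exact Cmult_comm].
  - destruct Hf as [[? ? ?] D]; split; [split; assumption|exact D].
  - destruct Hg as [[? ? ?] D]; split; [split; assumption|exact D]. }
destruct H as [[? ? ?] D]; split; [split; assumption|exact D].
Qed.

(** The quadratic Taylor estimate is uniform on a closed disc, so cutting the segment from
    [0] to [z] into [n] pieces gives an increment of order at most [1 / n]. *)
Lemma C_derive_0_constant (f : C -> C) (a : nat -> C) (z : C) :
  expansion f a -> (forall w, in_disc w -> C_derive f w = RtoC 0) -> in_disc z ->
  f z = f (RtoC 0).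
Proof.
intros Hf Hd Hz; assert (Hz0 := Cmod_ge_0 z).
assert (Hg := expansion_C_derive f a Hf).
destruct (expansion_Taylor_le f _ a (Cmod z) Hf Hg) as [T HT]; [split; auto|].
assert (step : forall n k, (k <= S n)%nat ->
  Cmod (f (RtoC (INR k / INR (S n)) * z)%C - f (RtoC 0)) <= INR k * (T * (Cmod z / INR (S n)) ^ 2)).
{ intros n k Hk.
  assert (Hn : 0 < INR (S n)) by (apply lt_0_INR; lia).
  induction k as [|k IH].
  - replace (RtoC (INR 0 / INR (S n)) * z)%C with (RtoC 0)
      by (unfold Rdiv; simpl; rewrite Rmult_0_l; ring).
    replace (f (RtoC 0) - f (RtoC 0))%C with (RtoC 0) by ring.
    rewrite Cmod_0; simpl; lra.
  - assert (small : forall j, (j <= S n)%nat ->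
      Cmod (RtoC (INR j / INR (S n)) * z) <= Cmod z).
    { intros j Hj; rewrite Cmod_mult, Cmod_R.
      assert (Hj' : INR j <= INR (S n)) by now apply le_INR.
      assert (Hj0 := pos_INR j).
      rewrite Rabs_pos_eq by (apply Rdiv_le_0_compat; lra).
      rewrite <- (Rmult_1_l (Cmod z)) at 2; apply Rmult_le_compat_r; [lra|].
      apply Rle_div_l; lra. }
    assert (Hk1 := small (S k) Hk).
    assert (Hk2 := small k ltac:(lia)).
    specialize (IH ltac:(lia)).
    specialize (HT _ _ Hk1 Hk2).
    rewrite Hd in HT by (red; unfold in_disc in Hz; lra).
    set (y1 := (RtoC (INR (S k) / INR (S n)) * z)%C) in *.
    set (y0 := (RtoC (INR k / INR (S n)) * z)%C) in *.
    replace (y1 - y0)%C with (RtoC (/ INR (S n)) * z)%C in HT.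
    2: { unfold y1, y0; rewrite (S_INR k); unfold Rdiv.
         rewrite !RtoC_mult, RtoC_plus; ring. }
    rewrite Cmod_mult, Cmod_R, Rabs_pos_eq in HT by (left; now apply Rinv_0_lt_compat).
    replace (f y1 - f (RtoC 0))%C with ((f y1 - f y0 - RtoC 0 * (RtoC (/ INR (S n)) * z)) + (f y0 - f (RtoC 0)))%C by ring.
    eapply Rle_trans; [apply Cmod_triangle|].
    replace (/ INR (S n) * Cmod z) with (Cmod z / INR (S n)) in HT by (unfold Rdiv; ring).
    rewrite (S_INR k); lra. }
assert (E : Cmod (f z - f (RtoC 0)) = 0).
{ apply Rle_antisym; [|apply Cmod_ge_0].
  apply (is_lim_seq_le (fun _ => Cmod (f z - f (RtoC 0)))
    (fun n => T * Cmod z ^ 2 * / INR (S n)) (Cmod (f z - f (RtoC 0))) 0).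
  - intros n; specialize (step n (S n) (le_n _)).
    assert (Hn : 0 < INR (S n)) by (apply lt_0_INR; lia).
    unfold Rdiv at 1 in step; rewrite Rinv_r, Cmult_1_l in step by lra.
    eapply Rle_trans; [exact step|]; right; field; lra.
  - apply is_lim_seq_const.
  - replace (Finite 0) with (Rbar_mult (T * Cmod z ^ 2) 0) by (simpl; f_equal; ring).
    apply is_lim_seq_scal_l.
    apply (is_lim_seq_incr_1 (fun n => / INR n)).
    apply (is_lim_seq_inv INR p_infty); [apply is_lim_seq_INR|easy]. }
apply Cmod_eq_0 in E.
replace (f z) with ((f z - f (RtoC 0)) + f (RtoC 0))%C by ring; rewrite E; ring.
Qed.

(** Course-of-values recursion for [(n + 1) g_(n+1) = sum_(k <= n) q_k g_(n-k)]: the prefix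
    of order [n] carries the coefficients of index at most [n]; its other values are junk. *)
Fixpoint ode_prefix (q : nat -> C) (n : nat) : nat -> C :=
  match n with
  | 0%nat => fun _ => RtoC 1
  | S n => fun m => if (m <=? n)%nat then ode_prefix q n m
                    else (Cauchy_coef q (ode_prefix q n) n / RtoC (INR (S n)))%C
  end.

Definition ode_coef (q : nat -> C) (n : nat) : C := ode_prefix q n n.

Lemma ode_prefixE (q : nat -> C) (n m : nat) : (m <= n)%nat -> ode_prefix q n m = ode_coef q m.
Proof.
induction n as [|n IH]; intros Hm; [now replace m with 0%nat by lia|].
destruct (Nat.eq_dec m (S n)) as [->|Hne]; [reflexivity|].
simpl; rewrite (proj2 (Nat.leb_le m n)) by lia; apply IH; lia.
Qed.

Lemma derive_ode_coef (q : nat -> C) (n : nat) :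
  derive_coef (ode_coef q) n = Cauchy_coef q (ode_coef q) n.
Proof.
unfold derive_coef, ode_coef at 1.
cbn [ode_prefix]; rewrite (proj2 (Nat.leb_gt (S n) n)) by lia.
replace (Cauchy_coef q (ode_prefix q n) n) with (Cauchy_coef q (ode_coef q) n).
- field; intros H; apply RtoC_inj in H; revert H; apply not_0_INR; lia.
- apply sum_n_ext_loc; intros k Hk; rewrite ode_prefixE; [reflexivity|lia].
Qed.

(** Once [n + 1] exceeds the sum of [|q_k| r ^ k], the recursion cannot increase the
    maximum of [|g_k| r ^ k]. *)
Lemma tame_ode_coef (q : nat -> C) : tame q -> tame (ode_coef q).
Proof.
intros Hq r Hr; destruct (tame_summable q r Hq Hr) as [s Hs].
destruct (INR_unbounded s) as [N HN].
assert (fin : forall n, exists K, 0 <= K /\ forall m, (m <= n)%nat -> Cmod (ode_coef q m) * r ^ m <= K).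
{ intros n; induction n as [|n [K [HK0 HK]]].
  - exists (Cmod (ode_coef q 0) * r ^ 0); split.
    + apply Rmult_le_pos; [apply Cmod_ge_0|apply pow_le; lra].
    + intros m Hm; replace m with 0%nat by lia; apply Rle_refl.
  - exists (Rmax K (Cmod (ode_coef q (S n)) * r ^ S n)); split.
    + eapply Rle_trans, Rmax_l; exact HK0.
    + intros m Hm; destruct (Nat.eq_dec m (S n)) as [->|Hne]; [apply Rmax_r|].
      eapply Rle_trans, Rmax_l; apply HK; lia. }
destruct (fin N) as [K [HK0 HK]]; exists K; intros n.
induction n as [n IH] using (well_founded_induction Wf_nat.lt_wf).
destruct (Nat.le_gt_cases n N) as [Hn|Hn]; [now apply HK|].
destruct n as [|n]; [lia|].
assert (HnR : 0 < INR (S n)) by (apply lt_0_INR; lia).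
assert (HNn : INR N <= INR (S n)) by (apply le_INR; lia).
apply Rmult_le_reg_l with (INR (S n)); [exact HnR|].
assert (E : INR (S n) * Cmod (ode_coef q (S n)) = Cmod (Cauchy_coef q (ode_coef q) n)).
{ rewrite <- derive_ode_coef; unfold derive_coef.
  rewrite Cmod_mult, Cmod_R, Rabs_pos_eq by lra; reflexivity. }
rewrite <- Rmult_assoc, E.
apply Rle_trans with (s * K); [|apply Rmult_le_compat_r; lra].
assert (B : Cmod (Cauchy_coef q (ode_coef q) n) * r ^ n <= s * K).
{ apply Rle_trans with (sum_n (fun k => Cmod (q k) * r ^ k) n * K).
  - eapply Rle_trans.
    + apply Rmult_le_compat_r; [apply pow_le; lra|apply Cmod_sum_n_le].
    + rewrite <- (sum_n_mult_r (K := R_Ring)), <- (sum_n_mult_r (K := R_Ring)).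
      change (sum_n (fun k => Cmod (q k * ode_coef q (n - k)) * r ^ n) n
        <= sum_n (fun k => Cmod (q k) * r ^ k * K) n).
      rewrite !sum_n_Reals; apply sum_Rle; intros k Hk.
      rewrite Cmod_mult.
      replace (r ^ n) with (r ^ k * r ^ (n - k)) by (rewrite <- pow_add; f_equal; lia).
      assert (H := IH (n - k)%nat ltac:(lia)).
      apply Rmult_le_compat_l with (r := Cmod (q k) * r ^ k) in H; [lra|].
      apply Rmult_le_pos; [apply Cmod_ge_0|apply pow_le; lra].
  - apply Rmult_le_compat_r; [exact HK0|].
    apply sum_n_le_series with (2 := Hs); intros k.
    apply Rmult_le_pos; [apply Cmod_ge_0|apply pow_le; lra]. }
eapply Rle_trans; [|exact B]; simpl.
assert (0 <= Cmod (Cauchy_coef q (ode_coef q) n) * r ^ n)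
  by (apply Rmult_le_pos; [apply Cmod_ge_0|apply pow_le; lra]).
nra.
Qed.

Lemma expansion_at_0 (f : C -> C) (a : nat -> C) : expansion f a -> f (RtoC 0) = a 0%nat.
Proof.
intros Hf; destruct (tame_expansion (fun n => a (S n))) as [g Hg].
{ now apply tame_shift, (expansion_tame f). }
rewrite (expansion_shift f g a Hf Hg); [ring|].
red; rewrite Cmod_0; lra.
Qed.

Lemma expansion_ext (f g : C -> C) (a b : nat -> C) :
  (forall z, in_disc z -> f z = g z) -> (forall n, a n = b n) -> expansion f a -> expansion g b.
Proof.
intros Hfg Hab Hf z Hz; rewrite <- Hfg by exact Hz.
now apply is_pseries_ext with a, Hf.
Qed.

Lemma linear_ode (Q : C -> C) (q : nat -> C) :
  expansion Q q ->
  exists g a, expansion g a /\ a 0%nat = RtoC 1 /\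
    (forall z, in_disc z -> C_derive g z = (Q z * g z)%C).
Proof.
intros HQ; assert (Tq := expansion_tame Q q HQ).
destruct (tame_expansion _ (tame_ode_coef q Tq)) as [g Hg].
exists g, (ode_coef q); split; [exact Hg|split; [reflexivity|]].
assert (H1 := expansion_C_derive g _ Hg).
assert (H2 := expansion_mult Q g _ _ HQ Hg).
rewrite expansion_series in H1, H2; intros z Hz.
apply is_Cseries_unique with (1 := H1 z Hz).
apply is_series_ext with (2 := H2 z Hz); intros n; now rewrite derive_ode_coef.
Qed.

(** The solution of the opposite equation is the inverse of [g]: the product of the two has
    zero derivative. *)
Lemma linear_ode_neq_0 (Q g : C -> C) (q a : nat -> C) (z : C) :
  expansion Q q -> expansion g a -> a 0%nat = RtoC 1 ->
  (forall z, in_disc z -> C_derive g z = (Q z * g z)%C) ->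
  in_disc z -> g z <> RtoC 0.
Proof.
intros HQ Hg Ha Hode Hz Hgz.
assert (HQ' : expansion (fun z => - Q z)%C (fun n => - q n)%C).
{ intros w Hw; apply (is_pseries_opp (V := C_NormedModule)), HQ, Hw. }
destruct (linear_ode _ _ HQ') as [h [b [Hh [Hb Hode']]]].
assert (P := expansion_mult g h a b Hg Hh).
assert (C0 : (g z * h z)%C = (g (RtoC 0) * h (RtoC 0))%C).
{ apply (C_derive_0_constant (fun z => g z * h z)%C _ z P); [|exact Hz].
  intros w Hw.
  rewrite (is_C_derive_unique _ w (Q w * g w * h w + g w * (- Q w * h w))%C); [ring|].
  rewrite <- (Hode w Hw), <- (Hode' w Hw).
  apply is_derive_Cmult.
  - apply (expansion_is_derive g _ a); [exact Hg|now apply expansion_C_derive|exact Hw].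
  - apply (expansion_is_derive h _ b); [exact Hh|now apply expansion_C_derive|exact Hw]. }
rewrite Hgz, (expansion_at_0 g a Hg), (expansion_at_0 h b Hh), Ha, Hb in C0.
apply (f_equal Re) in C0; simpl in C0; lra.
Qed.

(** * Coefficients of bounded functions *)

Lemma de_Moivre (t : R) (n : nat) : ((cos t, sin t) ^ n)%C = (cos (INR n * t), sin (INR n * t)).
Proof.
induction n as [|n IH].
- simpl; now rewrite Rmult_0_l, cos_0, sin_0.
- rewrite Cpow_S, IH, S_INR, Rmult_plus_distr_r, Rmult_1_l, cos_plus, sin_plus.
  unfold Cmult; simpl; f_equal; ring.
Qed.

Lemma primitive_root_of_unity (M : nat) : (0 < M)%nat ->
  exists x : C, Cmod x = 1 /\ (x ^ M)%C = RtoC 1 /\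
    forall j, (0 < j < M)%nat -> (x ^ j)%C <> RtoC 1.
Proof.
intros HM; assert (HMR : 0 < INR M) by now apply lt_0_INR.
exists (cos (2 * PI / INR M), sin (2 * PI / INR M)); repeat split.
- unfold Cmod; simpl fst; simpl snd.
  replace (_ + _) with 1; [apply sqrt_1|].
  rewrite <- (sin2_cos2 (2 * PI / INR M)); unfold Rsqr; ring.
- rewrite de_Moivre; replace (INR M * _) with (2 * PI) by (field; lra).
  now rewrite cos_2PI, sin_2PI.
- intros j Hj; rewrite de_Moivre; intros E; injection E as E _.
  set (t := PI * (INR j / INR M)).
  replace (INR j * _) with (2 * t) in E by (unfold t; field; lra).
  rewrite cos_2a_sin in E.
  assert (0 < INR j < INR M) by (split; [apply lt_0_INR|apply lt_INR]; lia).
  assert (0 < INR j / INR M < 1)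
    by (split; [apply Rdiv_lt_0_compat; lra|apply Rlt_div_l; lra]).
  assert (0 < sin t) by (assert (P := PI_RGT_0); apply sin_gt_0; unfold t; nra).
  nra.
Qed.

Lemma geometric_Csum (x : C) (n : nat) :
  ((x - 1) * Csum (fun k => x ^ k) n)%C = (x ^ S n - 1)%C.
Proof.
induction n as [|n IH].
- rewrite sum_O; simpl; ring.
- rewrite sum_Sn; change (plus _ _) with (Csum (fun k => x ^ k)%C n + x ^ S n)%C.
  rewrite Cmult_plus_distr_l, IH, !Cpow_S; ring.
Qed.

Lemma Csum_roots_of_unity (x : C) (m e : nat) :
  (x ^ S m)%C = RtoC 1 -> (forall j, (0 < j < S m)%nat -> (x ^ j)%C <> RtoC 1) ->
  (0 < e < 2 * S m)%nat ->
  Csum (fun k => (x ^ k) ^ e)%C m = if (e =? S m)%nat then RtoC (INR (S m)) else RtoC 0.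
Proof.
intros Hx Hprim He.
assert (sw : forall k, ((x ^ k) ^ e)%C = ((x ^ e) ^ k)%C)
  by (intros k; rewrite <- !Cpow_mult_r; f_equal; lia).
rewrite (sum_n_ext _ _ _ sw).
destruct (Nat.eqb_spec e (S m)) as [->|Hne].
- rewrite Hx; clear; induction m as [|m IH]; [now rewrite sum_O|].
  rewrite sum_Sn, IH, (S_INR (S m)), RtoC_plus, Cpow_1_l; reflexivity.
- assert (Hy : (x ^ e)%C <> RtoC 1).
  { destruct (Nat.lt_ge_cases e (S m)) as [H|H]; [apply Hprim; lia|].
    replace e with (S m + (e - S m))%nat by lia.
    rewrite Cpow_add_r, Hx, Cmult_1_l; apply Hprim; lia. }
  assert (G := geometric_Csum (x ^ e)%C m).
  rewrite <- Cpow_mult_r, Nat.mul_comm, Cpow_mult_r, Hx, Cpow_1_l in G.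
  assert (cancel : forall y s : C, y <> RtoC 1 -> ((y - 1) * s)%C = (1 - 1)%C -> s = RtoC 0).
  { intros y s Hne1 E.
    assert (N : (y - 1)%C <> RtoC 0).
    { intros E'; apply Hne1; replace y with ((y - 1) + 1)%C by ring; rewrite E'; ring. }
    replace s with (/ (y - 1) * ((y - 1) * s))%C by (field; exact N).
    rewrite E; ring. }
  exact (cancel _ _ Hy G).
Qed.

Lemma Csum_three_terms (u : nat -> C) (m : nat) :
  (forall n, (3 <= n <= S (S m))%nat -> u n = RtoC 0) ->
  Csum u (S (S m)) = (u 0%nat + u 1%nat + u 2%nat)%C.
Proof.
induction m as [|m IH]; intros Hu.
- rewrite !sum_Sn, sum_O; reflexivity.
- rewrite sum_Sn, IH, (Hu (S (S (S m)))) by (try intros; try apply Hu; lia).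
  apply Cplus_0_r.
Qed.

(** With [p = 1 + b z / r], the average of [w p ^ 2 * (r / z) ^ 2] over the circle of radius
    [r] is the left-hand side without its modulus, while that of [|p| ^ 2] is [1 + |b| ^ 2].  The average is taken over roots of unity, of an order exceeding the
    degree of a truncation of [w]. *)
Lemma bounded_coef_circle_le (w : C -> C) (c : nat -> C) (b : C) (r eps : R) :
  expansion w c -> (forall z, in_disc z -> Cmod (w z) <= 1) -> 0 <= r < 1 -> 0 < eps ->
  Cmod (c 2%nat * r ^ 2 + 2 * (c 1%nat * r) * b + c 0%nat * b ^ 2) <= (1 + eps) * (1 + Cmod b ^ 2).
Proof.
intros Hw Hbd Hr Heps; assert (Tc := expansion_tame w c Hw).
rewrite expansion_series in Hw.
assert (exists s : R, is_series (fun n => Cmod (c n) * r ^ n) s) as [s Hs]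
  by exact (tame_summable c r Tc Hr).
assert (exists m, s - sum_n (fun n => Cmod (c n) * r ^ n) (S (S m)) <= eps) as [m Hm].
{ destruct (Hs _ (locally_ball s (mkposreal eps Heps))) as [N HN].
  exists N; specialize (HN (S (S N)) ltac:(lia)).
  change (Rabs (sum_n (fun n => Cmod (c n) * r ^ n) (S (S N)) - s) < eps) in HN.
  apply Rabs_def2 in HN; lra. }
set (W := fun z => Csum (fun n => c n * z ^ n)%C (S (S m))).
assert (HW : forall z, Cmod z = r -> Cmod (W z) <= 1 + eps).
{ intros z Hz; assert (Dz : in_disc z) by (red; lra).
  replace (W z) with (w z + - (w z - W z))%C by ring.
  eapply Rle_trans; [apply Cmod_triangle|]; rewrite Cmod_opp.
  apply Rplus_le_compat; [now apply Hbd|]; eapply Rle_trans; [|exact Hm].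
  apply Cmod_series_le with (u := fun k => (c (S (S (S m)) + k)%nat * z ^ (S (S (S m)) + k))%C)
    (v := fun k => Cmod (c (S (S (S m)) + k)%nat) * r ^ (S (S (S m)) + k)).
  - intros n; rewrite Cmod_mult, Cmod_pow, Hz; apply Rle_refl.
  - apply (is_series_incr_n (V := C_NormedModule) (fun n => c n * z ^ n)%C); [lia|].
    change (is_Cseries (fun n => c n * z ^ n)%C (w z - W z + W z)%C).
    replace (w z - W z + W z)%C with (w z) by ring; now apply Hw.
  - apply (is_series_incr_n (V := R_NormedModule) (fun n => Cmod (c n) * r ^ n)); [lia|].
    change (is_series (fun n => Cmod (c n) * r ^ n)
      (s - sum_n (fun n => Cmod (c n) * r ^ n) (S (S m)) + sum_n (fun n => Cmod (c n) * r ^ n) (S (S m)))).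
    replace (_ + _) with s by ring; exact Hs. }
(* With [M = m + 5], the exponents [n + m + 3 + i], for [n <= m + 2] and [i <= 2], that
   occur below are less than [2 * M], and only [M] is a multiple of [M] among them. *)
set (M := (m + 5)%nat).
destruct (primitive_root_of_unity M) as [x [Hx1 [HxM Hxp]]]; [unfold M; lia|].
replace M with (S (m + 4)) in HxM, Hxp by (unfold M; lia).
assert (Hroots := fun e => Csum_roots_of_unity x (m + 4) e HxM Hxp).
assert (HM : 0 < INR M) by (apply lt_0_INR; unfold M; lia).
(* [(x ^ k) ^ (m + 3)] is [(x ^ k) ^ (-2)]. *)
set (K := fun k => ((x ^ k) ^ (m + 3) * (1 + b * x ^ k) ^ 2)%C).
set (X := Csum (fun k => W (r * x ^ k)%C * K k)%C (m + 4)).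
assert (moment : forall n, (n <= S (S m))%nat -> Csum (fun k => (x ^ k) ^ n * K k)%C (m + 4) =
   if (n =? 0)%nat then (INR M * b ^ 2)%C else
   if (n =? 1)%nat then (INR M * (2 * b))%C else
   if (n =? 2)%nat then RtoC (INR M) else RtoC 0).
{ intros n Hn.
  rewrite (sum_n_ext _ (fun k => plus (plus ((x ^ k) ^ (n + (m + 3)))%C
     (mult (2 * b) ((x ^ k) ^ (n + (m + 3) + 1)))%C)
     (mult (b ^ 2) ((x ^ k) ^ (n + (m + 3) + 2)))%C)).
  2: { intros k; unfold K.
       change (?f = _) with (f = (x ^ k) ^ (n + (m + 3)) + 2 * b * (x ^ k) ^ (n + (m + 3) + 1)
         + b ^ 2 * (x ^ k) ^ (n + (m + 3) + 2))%C.
       rewrite !Cpow_add_r; simpl; ring. }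
  rewrite !sum_n_plus, !(sum_n_mult_l (K := C_Ring)), !Hroots by (unfold M; lia).
  destruct n as [|[|[|n]]].
  - rewrite (proj2 (Nat.eqb_neq _ _)) by lia.
    rewrite (proj2 (Nat.eqb_neq _ _)) by lia.
    rewrite (proj2 (Nat.eqb_eq _ _)) by lia.
    replace (S (m + 4)) with M by (unfold M; lia).
    change (0 + (2 * b) * 0 + b ^ 2 * INR M = INR M * b ^ 2)%C; ring.
  - rewrite (proj2 (Nat.eqb_neq _ _)) by lia.
    rewrite (proj2 (Nat.eqb_eq _ _)) by lia.
    rewrite (proj2 (Nat.eqb_neq _ _)) by lia.
    replace (S (m + 4)) with M by (unfold M; lia).
    change (0 + (2 * b) * INR M + b ^ 2 * 0 = INR M * (2 * b))%C; ring.
  - rewrite (proj2 (Nat.eqb_eq _ _)) by lia.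
    rewrite (proj2 (Nat.eqb_neq _ _)) by lia.
    rewrite (proj2 (Nat.eqb_neq _ _)) by lia.
    replace (S (m + 4)) with M by (unfold M; lia).
    change (INR M + (2 * b) * 0 + b ^ 2 * 0 = INR M)%C; ring.
  - do 3 rewrite (proj2 (Nat.eqb_neq _ _)) by lia.
    change (0 + (2 * b) * 0 + b ^ 2 * 0 = 0)%C; ring. }
assert (EX : X = (INR M * (c 2%nat * r ^ 2 + 2 * (c 1%nat * r) * b + c 0%nat * b ^ 2))%C).
{ unfold X.
  rewrite (sum_n_ext _ (fun k => Csum (fun n => c n * r ^ n * ((x ^ k) ^ n * K k))%C (S (S m)))).
  2: { intros k; unfold W.
       rewrite <- (sum_n_mult_r (K := C_Ring)); apply sum_n_ext; intros n.
       change (c n * (r * x ^ k) ^ n * K k = c n * r ^ n * ((x ^ k) ^ n * K k))%C.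
       rewrite Cpow_mult_l; ring. }
  rewrite sum_n_switch.
  rewrite (sum_n_ext_loc _ (fun n => c n * r ^ n * (if (n =? 0)%nat then INR M * b ^ 2 else
   if (n =? 1)%nat then INR M * (2 * b) else
   if (n =? 2)%nat then RtoC (INR M) else RtoC 0))%C).
  2: { intros n Hn; rewrite <- moment by exact Hn.
       apply (sum_n_mult_l (K := C_Ring)). }
  rewrite Csum_three_terms; [simpl; ring|].
  intros [|[|[|n]]] Hn; try lia; simpl; ring. }
assert (mean : sum_n (fun k => Cmod (1 + b * x ^ k) ^ 2) (m + 4) = INR M * (1 + Cmod b ^ 2)).
{ rewrite (sum_n_ext _ (fun k => plus (1 + Cmod b ^ 2) (Re (2 * b * (x ^ k) ^ 1)%C))).
  - rewrite sum_n_plus, sum_n_const, <- Re_sum_n.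
    rewrite (sum_n_mult_l (K := C_Ring)), Hroots by lia.
    rewrite (proj2 (Nat.eqb_neq _ _)) by lia.
    change (INR (S (m + 4)) * (1 + Cmod b ^ 2) + Re (2 * b * 0)%C = INR M * (1 + Cmod b ^ 2)).
    rewrite Cmult_0_r; simpl Re; replace (S (m + 4)) with M by (unfold M; lia); ring.
  - intros k; unfold plus; simpl plus.
    assert (N : Cmod (x ^ k) ^ 2 = 1) by (rewrite Cmod_pow, Hx1, pow1; ring).
    rewrite Cmod2_alt in N |- *; rewrite Cmod2_alt.
    change ((x ^ k) ^ 1)%C with (x ^ k * 1)%C; rewrite Cmult_1_r.
    destruct (x ^ k)%C as [p q], b as [b1 b2]; simpl in *.
    replace (_ + _) with (1 + 2 * (b1 * p - b2 * q) + (b1 * b1 + b2 * b2) * (p * (p * 1) + q * (q * 1))) by ring.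
    rewrite N; ring. }
apply Rmult_le_reg_l with (INR M); [exact HM|].
replace (INR M * ((1 + eps) * (1 + Cmod b ^ 2))) with ((1 + eps) * (INR M * (1 + Cmod b ^ 2))) by ring.
rewrite <- mean, <- (Rabs_pos_eq (INR M)) at 1 by lra.
rewrite <- Cmod_R, <- Cmod_mult, <- EX.
eapply Rle_trans; [apply Cmod_sum_n_le|].
rewrite <- (sum_n_mult_l (K := R_Ring)).
apply sum_n_m_le; intros k.
change (Cmod (W (r * x ^ k)%C * K k) <= (1 + eps) * Cmod (1 + b * x ^ k) ^ 2).
unfold K; rewrite !Cmod_mult, !Cmod_pow, Hx1, !pow1, Rmult_1_l.
apply Rmult_le_compat_r; [apply pow2_ge_0|apply HW].
rewrite Cmod_mult, Cmod_pow, Hx1, pow1, Cmod_R, Rabs_pos_eq; lra.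
Qed.

(** The estimate on circles, with the radius tending to [1]. *)
Lemma bounded_coef_quadratic_le (w : C -> C) (c : nat -> C) (b : C) :
  expansion w c -> (forall z, in_disc z -> Cmod (w z) <= 1) ->
  Cmod (c 2%nat + 2 * c 1%nat * b + c 0%nat * b ^ 2) <= 1 + Cmod b ^ 2.
Proof.
intros Hw Hbd; apply le_epsilon; intros e He.
set (k := Cmod b ^ 2); assert (Hk : 0 <= k) by apply pow2_ge_0.
set (L := 1 + k + 2 * Cmod (c 2%nat) + Cmod (2 * c 1%nat * b)).
assert (H2 := Cmod_ge_0 (c 2%nat)); assert (H1 := Cmod_ge_0 (2 * c 1%nat * b)).
assert (HL : 0 < L) by (unfold L; lra).
set (d := Rmin 1 (e / L)).
assert (Hd : 0 < d) by (apply Rmin_pos; [lra|now apply Rdiv_lt_0_compat]).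
assert (Hd1 : d <= 1) by apply Rmin_l.
assert (HdL : d * L <= e) by (apply Rle_div_r; [lra|apply Rmin_r]).
assert (H := bounded_coef_circle_le w c b (1 - d) d Hw Hbd ltac:(lra) Hd).
replace (c 2%nat + 2 * c 1%nat * b + c 0%nat * b ^ 2)%C with
  ((c 2%nat * (1 - d)%R ^ 2 + 2 * (c 1%nat * (1 - d)%R) * b + c 0%nat * b ^ 2)
   + (RtoC (d * (2 - d)) * c 2%nat + RtoC d * (2 * c 1%nat * b)))%C.
2: { rewrite RtoC_mult, !RtoC_minus; ring. }
eapply Rle_trans; [apply Cmod_triangle|].
assert (T : Cmod (RtoC (d * (2 - d)) * c 2%nat + RtoC d * (2 * c 1%nat * b)) <=
  d * (2 * Cmod (c 2%nat) + Cmod (2 * c 1%nat * b))).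
{ eapply Rle_trans; [apply Cmod_triangle|].
  rewrite !(Cmod_mult (RtoC _)), !Cmod_R, !Rabs_pos_eq by nra.
  assert (d * (2 - d) * Cmod (c 2%nat) <= d * 2 * Cmod (c 2%nat))
    by (apply Rmult_le_compat_r; nra).
  lra. }
fold k in H; unfold L in HdL; lra.
Qed.

(** The Schwarz-Pick estimate on the second coefficient: when [c 0 = 0], take [b] of modulus
    [|c 1|] such that [c 1 * b] has the argument of [c 2]. *)
Lemma Schwarz_coef_le (w : C -> C) (c : nat -> C) :
  expansion w c -> (forall z, in_disc z -> Cmod (w z) <= 1) -> c 0%nat = RtoC 0 ->
  Cmod (c 2%nat) <= 1 - Cmod (c 1%nat) ^ 2.
Proof.
intros Hw Hbd H0.
assert (exists u, Cmod u = 1 /\ c 2%nat = (u * RtoC (Cmod (c 2%nat)))%C) as [u [Hu E2]].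
{ destruct (Req_dec (Cmod (c 2%nat)) 0) as [E|E].
  - exists (RtoC 1); split; [apply Cmod_1|].
    rewrite (Cmod_eq_0 _ E), Cmod_0; ring.
  - exists (c 2%nat / RtoC (Cmod (c 2%nat)))%C.
    assert (N : RtoC (Cmod (c 2%nat)) <> RtoC 0) by (intros H; now apply RtoC_inj in H).
    split; [|field; exact N].
    rewrite Cmod_div, Cmod_R, Rabs_pos_eq by (try apply Cmod_ge_0; exact N).
    now apply Rinv_r. }
assert (H := bounded_coef_quadratic_le w c (u * Cconj (c 1%nat))%C Hw Hbd).
assert (C1 : (c 1%nat * Cconj (c 1%nat))%C = RtoC (Cmod (c 1%nat) ^ 2))
  by (now rewrite <- Cmod2_conj, RtoC_pow).
replace (_ + _)%C with (u * RtoC (Cmod (c 2%nat) + 2 * Cmod (c 1%nat) ^ 2))%C in H.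
2: { rewrite RtoC_plus, RtoC_mult, <- C1, H0; rewrite E2 at 2; ring. }
rewrite !Cmod_mult, Hu, Cmod_R, Cmod_conj, !Rmult_1_l in H.
assert (T := Rle_abs (Cmod (c 2%nat) + 2 * Cmod (c 1%nat) ^ 2)).
lra.
Qed.

(** * Second order expansions at the origin *)

Definition bounded_near0 (G : C -> C) : Prop :=
  exists K d, 0 < d /\ forall z, Cmod z < d -> Cmod (G z) <= K.

Lemma bounded_near0_const (c : C) : bounded_near0 (fun _ => c).
Proof. exists (Cmod c), 1; split; [lra|intros; apply Rle_refl]. Qed.

Lemma bounded_near0_id : bounded_near0 (fun z => z).
Proof. exists 1, 1; split; [lra|intros; lra]. Qed.

Lemma bounded_near0_plus (F G : C -> C) :
  bounded_near0 F -> bounded_near0 G -> bounded_near0 (fun z => F z + G z)%C.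
Proof.
intros [K [d [Hd HF]]] [L [e [He HG]]].
exists (K + L), (Rmin d e); split; [now apply Rmin_pos|]; intros z Hz.
eapply Rle_trans; [apply Cmod_triangle|].
apply Rplus_le_compat; [apply HF|apply HG]; (eapply Rlt_le_trans; [exact Hz|auto using Rmin_l, Rmin_r]).
Qed.

Lemma bounded_near0_mult (F G : C -> C) :
  bounded_near0 F -> bounded_near0 G -> bounded_near0 (fun z => F z * G z)%C.
Proof.
intros [K [d [Hd HF]]] [L [e [He HG]]].
exists (K * L), (Rmin d e); split; [now apply Rmin_pos|]; intros z Hz.
rewrite Cmod_mult; apply Rmult_le_compat; try apply Cmod_ge_0;
  [apply HF|apply HG]; (eapply Rlt_le_trans; [exact Hz|auto using Rmin_l, Rmin_r]).
Qed.

Lemma bounded_near0_comp (F w : C -> C) :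
  bounded_near0 F -> bounded_near0 w -> bounded_near0 (fun z => F (z * w z)%C).
Proof.
intros [K [d [Hd HF]]] [L [e [He HG]]].
exists K, (Rmin e (d / (Rabs L + 1))).
assert (HL := Rabs_pos L); assert (HL' := Rle_abs L).
split; [apply Rmin_pos; [lra|apply Rdiv_lt_0_compat; lra]|]; intros z Hz.
assert (Hz1 : Cmod z < e) by (eapply Rlt_le_trans; [exact Hz|apply Rmin_l]).
assert (Hz2 : Cmod z < d / (Rabs L + 1)) by (eapply Rlt_le_trans; [exact Hz|apply Rmin_r]).
apply HF; rewrite Cmod_mult; apply Rlt_div_r in Hz2; [|lra].
specialize (HG z Hz1); assert (H0 := Cmod_ge_0 z).
apply Rle_lt_trans with (2 := Hz2), Rmult_le_compat_l; lra.
Qed.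

Lemma bounded_near0_expansion (G : C -> C) (a : nat -> C) : expansion G a -> bounded_near0 G.
Proof.
intros HG; assert (Ha := expansion_tame _ _ HG).
destruct (tame_summable a (/ 2) Ha) as [s Hs]; [lra|].
rewrite expansion_series in HG.
exists s, (/ 2); split; [lra|]; intros z Hz.
assert (Dz : in_disc z) by (red; lra).
apply Cmod_series_le with (2 := HG z Dz) (3 := Hs).
intros n; rewrite Cmod_mult, Cmod_pow.
apply Rmult_le_compat_l; [apply Cmod_ge_0|].
apply pow_incr; split; [apply Cmod_ge_0|lra].
Qed.

Create HintDb near0.
#[local] Hint Resolve bounded_near0_const bounded_near0_id bounded_near0_plus
  bounded_near0_mult bounded_near0_comp : near0.

Definition jet2 (F : C -> C) (a0 a1 a2 : C) : Prop :=
  exists G, bounded_near0 G /\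
    forall z, in_disc z -> F z = (a0 + a1 * z + a2 * z ^ 2 + z ^ 3 * G z)%C.

Lemma expansion_jet2 (f : C -> C) (a : nat -> C) :
  expansion f a -> jet2 f (a 0%nat) (a 1%nat) (a 2%nat).
Proof.
intros Hf; assert (T0 := expansion_tame f a Hf).
assert (T1 := tame_shift _ T0); assert (T2 := tame_shift _ T1); assert (T3 := tame_shift _ T2).
destruct (tame_expansion _ T1) as [f1 H1].
destruct (tame_expansion _ T2) as [f2 H2].
destruct (tame_expansion _ T3) as [f3 H3].
exists f3; split; [now apply (bounded_near0_expansion f3 _ H3)|]; intros z Hz.
rewrite (expansion_shift _ _ _ Hf H1 z Hz), (expansion_shift _ _ _ H1 H2 z Hz),
  (expansion_shift _ _ _ H2 H3 z Hz); ring.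
Qed.

Lemma jet2_ext (F G : C -> C) (a0 a1 a2 : C) :
  (forall z, in_disc z -> F z = G z) -> jet2 F a0 a1 a2 -> jet2 G a0 a1 a2.
Proof.
intros E [H [HB HE]]; exists H; split; [exact HB|].
intros z Hz; rewrite <- E; auto.
Qed.

Lemma jet2_plus (F G : C -> C) (a0 a1 a2 b0 b1 b2 : C) :
  jet2 F a0 a1 a2 -> jet2 G b0 b1 b2 ->
  jet2 (fun z => F z + G z)%C (a0 + b0) (a1 + b1) (a2 + b2).
Proof.
intros [U [HU EF]] [V [HV EG]].
exists (fun z => U z + V z)%C; split; [auto with near0|].
intros z Hz; rewrite EF, EG by exact Hz; ring.
Qed.

Lemma jet2_mult (F G : C -> C) (a0 a1 a2 b0 b1 b2 : C) :
  jet2 F a0 a1 a2 -> jet2 G b0 b1 b2 ->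
  jet2 (fun z => F z * G z)%C (a0 * b0) (a0 * b1 + a1 * b0) (a0 * b2 + a1 * b1 + a2 * b0).
Proof.
intros [U [HU EF]] [V [HV EG]].
exists (fun z => (a1 * b2 + a2 * b1 + a2 * b2 * z) + (a0 + a1 * z + a2 * (z * z)) * V z
  + U z * (b0 + b1 * z + b2 * (z * z) + z * (z * z) * V z))%C.
split; [auto 20 with near0|].
intros z Hz; rewrite EF, EG by exact Hz; ring.
Qed.

Lemma jet2_comp (F w : C -> C) (a0 a1 a2 c1 c2 : C) :
  jet2 F a0 a1 a2 -> jet2 w 0 c1 c2 -> (forall z, in_disc z -> in_disc (w z)) ->
  jet2 (fun z => F (w z)) a0 (a1 * c1) (a1 * c2 + a2 * c1 ^ 2).
Proof.
intros [U [HU EF]] [V [HV Ew]] Hw.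
(* [q z] is the quotient [w z / z]. *)
set (q := fun z => (c1 + c2 * z + z * z * V z)%C).
assert (Hq : bounded_near0 q) by (unfold q; auto 20 with near0).
exists (fun z => a1 * V z + a2 * (RtoC 2 * c1 * c2 + c2 * c2 * z
   + RtoC 2 * (c1 + c2 * z) * z * V z + z * z * z * (V z * V z)) +
   (q z * (q z * q z)) * U (z * q z))%C.
split; [auto 30 with near0|].
intros z Hz; rewrite EF by auto.
replace (z * q z)%C with (w z) by (rewrite Ew by exact Hz; unfold q; ring).
rewrite Ew by exact Hz; unfold q; ring.
Qed.

(** Letting [z] tend to [0] along the positive reals. *)
Lemma bounded_near0_const_eq_0 (c : C) (G : C -> C) :
  bounded_near0 G -> (forall z, in_disc z -> z <> RtoC 0 -> c = (z * G z)%C) -> c = RtoC 0.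
Proof.
intros [K [d [Hd HG]]] E; apply Cmod_eq_0, Rle_antisym; [|apply Cmod_ge_0].
apply le_epsilon; intros e He; rewrite Rplus_0_l.
assert (HK := Rabs_pos K); assert (HK' := Rle_abs K).
set (t := Rmin (Rmin d 1 / 2) (e / (Rabs K + 1))).
assert (Hd1 : 0 < Rmin d 1) by (apply Rmin_pos; lra).
assert (Ht : 0 < t) by (apply Rmin_pos; [lra|apply Rdiv_lt_0_compat; lra]).
assert (Ht1 : t <= Rmin d 1 / 2) by apply Rmin_l.
assert (Ht2 : t <= e / (Rabs K + 1)) by apply Rmin_r.
assert (M1 := Rmin_l d 1); assert (M2 := Rmin_r d 1).
assert (Ct : Cmod (RtoC t) = t) by (rewrite Cmod_R; apply Rabs_pos_eq; lra).
rewrite (E (RtoC t)).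
- rewrite Cmod_mult, Ct; apply Rle_div_r in Ht2; [|lra].
  apply Rle_trans with (2 := Ht2), Rmult_le_compat_l; [lra|].
  eapply Rle_trans; [apply HG; lra|lra].
- red; lra.
- intros H; apply RtoC_inj in H; lra.
Qed.

Lemma jet2_unique (F : C -> C) (a0 a1 a2 b0 b1 b2 : C) :
  jet2 F a0 a1 a2 -> jet2 F b0 b1 b2 -> a0 = b0 /\ a1 = b1 /\ a2 = b2.
Proof.
intros [U [HU EU]] [V [HV EV]].
assert (E : forall z, in_disc z ->
  ((b0 - a0) + (b1 - a1) * z + (b2 - a2) * z ^ 2 + z ^ 3 * (V z + - (1) * U z))%C = RtoC 0).
{ intros z Hz.
  replace (_ + _)%C with
    ((b0 + b1 * z + b2 * z ^ 2 + z ^ 3 * V z) - (a0 + a1 * z + a2 * z ^ 2 + z ^ 3 * U z))%C by ring.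
  rewrite <- EU, <- EV by exact Hz; ring. }
assert (eq_of_sub : forall x y : C, (y - x)%C = RtoC 0 -> x = y).
{ intros x y H; replace y with ((y - x) + x)%C by ring; rewrite H; ring. }
set (W := fun z => (V z + - (1) * U z)%C) in *.
assert (HW : bounded_near0 W) by (unfold W; auto with near0).
assert (E0 : (b0 - a0)%C = RtoC 0).
{ apply bounded_near0_const_eq_0 with
    (fun z => - (1) * ((b1 - a1) + (b2 - a2) * z + z * z * W z))%C; [auto 20 with near0|].
  intros z Hz _; rewrite <- (Cplus_0_r (b0 - a0)), <- (Copp_0), <- (E z Hz); fold (W z); ring. }
assert (E1 : (b1 - a1)%C = RtoC 0).
{ apply bounded_near0_const_eq_0 with
    (fun z => - (1) * ((b2 - a2) + z * W z))%C; [auto 20 with near0|].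
  intros z Hz Nz; specialize (E z Hz); rewrite E0 in E; fold (W z) in E.
  replace (b1 - a1)%C with
   (/ z * (0 + (b1 - a1) * z + (b2 - a2) * z ^ 2 + z ^ 3 * W z)
     + z * (- (1) * ((b2 - a2) + z * W z)))%C by (field; exact Nz).
  rewrite E; ring. }
assert (E2 : (b2 - a2)%C = RtoC 0).
{ apply bounded_near0_const_eq_0 with (fun z => - (1) * W z)%C; [auto 20 with near0|].
  intros z Hz Nz; specialize (E z Hz); rewrite E0, E1 in E; fold (W z) in E.
  replace (b2 - a2)%C with
   (/ (z * z) * (0 + 0 * z + (b2 - a2) * z ^ 2 + z ^ 3 * W z)
     + z * (- (1) * W z))%C by (field; exact Nz).
  rewrite E; ring. }
auto.
Qed.

(** * Coefficients of functions of the class *)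

(** Comparison of coefficients up to [z ^ 2] in [f' + z f'' = f' * (phi o w)]. *)
Lemma convex_coef (phi f w : C -> C) (a c : nat -> C) (B : nat -> R) :
  expansion phi (fun n => RtoC (B n)) -> B 0%nat = 1 ->
  expansion f a -> a 1%nat = RtoC 1 -> (forall z, in_disc z -> C_derive f z <> RtoC 0) ->
  expansion w c -> c 0%nat = RtoC 0 -> (forall z, in_disc z -> in_disc (w z)) ->
  (forall z, in_disc z -> (1 + z * C_derive (C_derive f) z / C_derive f z)%C = phi (w z)) ->
  (2 * a 2%nat = B 1%nat * c 1%nat)%C /\
  (6 * a 3%nat = B 1%nat * c 2%nat + B 2%nat * c 1%nat ^ 2 + (B 1%nat * c 1%nat) ^ 2)%C.
Proof.
intros HB B0 Ha a1 Hne Hc c0 Hw Heq.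
assert (D1 := expansion_C_derive f a Ha).
assert (D2 := expansion_C_derive _ _ D1).
assert (J1 := expansion_jet2 _ _ D1).
assert (J2 := expansion_jet2 _ _ D2).
assert (Jw := expansion_jet2 _ _ Hc); rewrite c0 in Jw.
assert (Jphi := jet2_comp _ _ _ _ _ _ _ (expansion_jet2 _ _ HB) Jw Hw).
assert (Jz : jet2 (fun z => z) 0 1 0).
{ exists (fun _ => RtoC 0); split; [auto with near0|intros; ring]. }
assert (L := jet2_plus _ _ _ _ _ _ _ _ J1 (jet2_mult _ _ _ _ _ _ _ _ Jz J2)).
assert (R := jet2_mult _ _ _ _ _ _ _ _ J1 Jphi).
apply (jet2_ext _ (fun z => C_derive f z * phi (w z))%C) in L.
2: { intros z Hz; rewrite <- Heq by exact Hz; field; now apply Hne. }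
destruct (jet2_unique _ _ _ _ _ _ _ L R) as [_ [E1 E2]].
unfold derive_coef in E1, E2; rewrite a1, B0 in *.
simpl INR in E1, E2; repeat rewrite RtoC_plus in E1; repeat rewrite RtoC_plus in E2.
assert (A2 : (2 * a 2%nat = B 1%nat * c 1%nat)%C).
{ match type of E1 with ?l = _ =>
    replace (2 * a 2%nat)%C with (l - 2 * a 2%nat)%C by ring end.
  rewrite E1; ring. }
split; [exact A2|].
match type of E2 with ?l = _ =>
  replace (6 * a 3%nat)%C with (l - 3 * a 3%nat)%C by ring end.
rewrite E2, <- A2; ring.
Qed.

(** * Existence of functions with prescribed subordination *)

Lemma expansion_unique_value (f g : C -> C) (a b : nat -> C) (z : C) :
  expansion f a -> expansion g b -> (forall n, a n = b n) -> in_disc z -> f z = g z.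
Proof.
rewrite !expansion_series; intros Hf Hg Hab Hz.
apply is_Cseries_unique with (1 := Hf z Hz).
apply is_series_ext with (2 := Hg z Hz); intros n; now rewrite Hab.
Qed.

Lemma expansion_monomial (k : nat) :
  expansion (fun z => z ^ k)%C (fun n => if (n =? k)%nat then RtoC 1 else RtoC 0).
Proof.
apply expansion_series; intros z _.
assert (zero : is_Cseries (fun n => RtoC 0 * z ^ n)%C (RtoC 0)).
{ apply filterlim_ext with (fun _ => RtoC 0); [|apply filterlim_const].
  intros n; induction n as [|n IH]; [rewrite sum_O|rewrite sum_Sn, <- IH];
  [|change (RtoC 0 = 0 + 0 * z ^ S n)%C]; ring. }
induction k as [|k IH].
- replace (z ^ 0)%C with (RtoC 1 + z * 0)%C by (change (z ^ 0)%C with (RtoC 1); ring).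
  apply (is_Cseries_shift (fun n => if (n =? 0)%nat then RtoC 1 else RtoC 0) z (RtoC 0) zero).
- replace (z ^ S k)%C with (RtoC 0 + z * z ^ k)%C by (rewrite Cpow_S; ring).
  apply (is_Cseries_shift (fun n => if (n =? S k)%nat then RtoC 1 else RtoC 0) z _ IH).
Qed.

Lemma expansion_comp_square (f : C -> C) (a : nat -> C) :
  expansion f a ->
  expansion (fun z => f (z ^ 2)%C) (fun n => if Nat.even n then a (Nat.div2 n) else RtoC 0).
Proof.
rewrite !expansion_series; intros Hf z Hz.
assert (Hz2 : in_disc (z ^ 2)%C).
{ unfold in_disc in *; rewrite Cmod_pow; assert (H := Cmod_ge_0 z); simpl; nra. }
assert (E : forall n, Csum
    (fun n => (if Nat.even n then a (Nat.div2 n) else RtoC 0) * z ^ n)%C n =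
  Csum (fun n => a n * (z ^ 2) ^ n)%C (Nat.div2 n)).
{ assert (H : forall m,
    Csum
      (fun n => (if Nat.even n then a (Nat.div2 n) else RtoC 0) * z ^ n)%C (2 * m) =
    Csum (fun n => a n * (z ^ 2) ^ n)%C m /\
    Csum
      (fun n => (if Nat.even n then a (Nat.div2 n) else RtoC 0) * z ^ n)%C (S (2 * m)) =
    Csum (fun n => a n * (z ^ 2) ^ n)%C m).
  { assert (odd : forall m x, Csum
      (fun n => (if Nat.even n then a (Nat.div2 n) else RtoC 0) * z ^ n)%C (2 * m) = x ->
      Csum
      (fun n => (if Nat.even n then a (Nat.div2 n) else RtoC 0) * z ^ n)%C (S (2 * m)) = x).
    { intros m x Hx; rewrite sum_Sn, Hx, Nat.even_succ, <- Nat.negb_even, Nat.even_even.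
      change (x + 0 * z ^ S (2 * m) = x)%C; ring. }
    induction m as [|m [IH1 IH2]].
    - split; [|apply odd]; simpl Nat.mul; rewrite !sum_O; reflexivity.
    - assert (H2 : Csum
        (fun n => (if Nat.even n then a (Nat.div2 n) else RtoC 0) * z ^ n)%C (2 * S m) =
        Csum (fun n => a n * (z ^ 2) ^ n)%C (S m)).
      { replace (2 * S m)%nat with (S (S (2 * m))) by lia.
        rewrite sum_Sn, IH2, sum_Sn; f_equal.
        replace (S (S (2 * m))) with (2 * S m)%nat by lia.
        rewrite Nat.even_even, Nat.div2_double, Cpow_mult_r; reflexivity. }
      split; [exact H2|now apply odd]. }
  intros n; destruct (Nat.Even_or_Odd n) as [[m ->]|[m ->]].
  - rewrite Nat.div2_double; apply H.
  - rewrite Nat.add_1_r, Nat.div2_succ_double; apply H. }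
intros P HP; destruct (Hf _ Hz2 P HP) as [N HN].
exists (2 * N)%nat; intros n Hn; rewrite E; apply HN.
destruct (Nat.Even_or_Odd n) as [[m ->]|[m ->]];
  rewrite ?Nat.add_1_r, ?Nat.div2_double, ?Nat.div2_succ_double; lia.
Qed.

(** The derivative of [f] solves [g' = Q g], where [h z = 1 + z * Q z]. *)
Lemma convex_of_expansion (h : C -> C) (b : nat -> C) :
  expansion h b -> b 0%nat = RtoC 1 ->
  exists f a, expansion f a /\ a 0%nat = RtoC 0 /\ a 1%nat = RtoC 1 /\
    (forall z, in_disc z -> C_derive f z <> RtoC 0) /\
    (forall z, in_disc z -> (1 + z * C_derive (C_derive f) z / C_derive f z)%C = h z).
Proof.
intros Hh Hb.
destruct (tame_expansion _ (tame_shift _ (expansion_tame _ _ Hh))) as [Q HQ].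
destruct (linear_ode _ _ HQ) as [g [e [Hg [He Hode]]]].
set (a := fun n => match n with 0%nat => RtoC 0 | S m => (e m / RtoC (INR (S m)))%C end).
assert (Nz : forall n, RtoC (INR (S n)) <> RtoC 0).
{ intros n H; apply RtoC_inj in H; revert H; now apply not_0_INR. }
assert (Ea : forall n, derive_coef a n = e n).
{ intros n; unfold derive_coef, a; field; apply Nz. }
assert (Ta : tame a).
{ intros r Hr; destruct (expansion_tame _ _ Hg r Hr) as [K HK].
  exists K; assert (K0 : 0 <= K).
  { eapply Rle_trans; [|apply (HK 0%nat)]; apply Rmult_le_pos; [apply Cmod_ge_0|apply pow_le; lra]. }
  intros [|n]; unfold a; [rewrite Cmod_0; lra|].
  rewrite Cmod_div, Cmod_R, Rabs_pos_eq by (try apply pos_INR; apply Nz).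
  specialize (HK n); assert (H0 := Cmod_ge_0 (e n)).
  assert (H1 : 1 <= INR (S n)) by (rewrite S_INR; assert (H := pos_INR n); lra).
  assert (Hr0 : 0 <= r ^ n) by (apply pow_le; lra).
  assert (D : Cmod (e n) / INR (S n) <= Cmod (e n)) by (apply Rle_div_l; nra).
  assert (D0 : 0 <= Cmod (e n) / INR (S n)) by (apply Rdiv_le_0_compat; lra).
  eapply Rle_trans; [|exact HK]; simpl pow.
  apply Rmult_le_compat; [exact D0|nra|exact D|nra]. }
destruct (tame_expansion a Ta) as [f Hf].
exists f, a; split; [exact Hf|split; [reflexivity|split]].
{ unfold a; rewrite He; simpl; field. }
assert (D1 := expansion_C_derive f a Hf).
assert (F1 : forall z, in_disc z -> C_derive f z = g z)
  by (intros z; exact (expansion_unique_value _ _ _ _ z D1 Hg Ea)).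
assert (F2 : forall z, in_disc z -> C_derive (C_derive f) z = C_derive g z).
{ intros z; apply (expansion_unique_value _ _ _ _ z (expansion_C_derive _ _ D1)
    (expansion_C_derive _ _ Hg)).
  intros n; unfold derive_coef at 1; now rewrite Ea. }
assert (G0 : forall z, in_disc z -> g z <> RtoC 0)
  by (intros z Hz; now apply (linear_ode_neq_0 Q g _ e z HQ Hg He Hode)).
split; intros z Hz; [rewrite F1; auto|].
rewrite F1, F2, Hode, (expansion_shift _ _ _ Hh HQ z Hz), Hb by exact Hz.
field; now apply G0.
Qed.

(** * The determinant *)

(** Completing the square [2 Re (a2 ^ 2 * conj a3) - |a3| ^ 2] leaves [a3] in one term, where
    only the size of the distance to [a2 ^ 2] matters. *)
Lemma det_T31_squares (a : nat -> C) : a 1%nat = RtoC 1 ->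
  det_T31 a = 1 - 2 * Cmod (a 2%nat) ^ 2 + (Cmod (a 2%nat) ^ 2) ^ 2
              - Cmod (a 3%nat - a 2%nat ^ 2) ^ 2.
Proof.
intros a1; unfold det_T31; rewrite det3_hermitian_toeplitzE by exact a1.
rewrite !Cmod2_alt; destruct (a 2%nat) as [p q], (a 3%nat) as [r s]; simpl; ring.
Qed.

(** The lower bound for the determinant obtained when [t = |c 1| ^ 2] and [|c 2|] is replaced
    by its bound [1 - t]. *)
Definition det_profile (B1 B2 t : R) : R :=
  1 - B1 ^ 2 * t / 2 + B1 ^ 4 * t ^ 2 / 16 - (B1 * (1 - t) + (B1 ^ 2 / 2 - B2) * t) ^ 2 / 36.

Lemma RtoC_neq_0 (x : R) : x <> 0 -> RtoC x <> RtoC 0.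
Proof. intros Hx H; now apply RtoC_inj in H. Qed.

Lemma det_T31_ge (a c : nat -> C) (B1 B2 : R) :
  0 < B1 -> 2 * B2 <= B1 ^ 2 -> a 1%nat = RtoC 1 ->
  (2 * a 2%nat = B1 * c 1%nat)%C ->
  (6 * a 3%nat = B1 * c 2%nat + B2 * c 1%nat ^ 2 + (B1 * c 1%nat) ^ 2)%C ->
  Cmod (c 2%nat) <= 1 - Cmod (c 1%nat) ^ 2 ->
  det_profile B1 B2 (Cmod (c 1%nat) ^ 2) <= det_T31 a.
Proof.
intros HB1 HB2 a1 E2 E3 Hc; rewrite det_T31_squares by exact a1.
set (t := Cmod (c 1%nat) ^ 2) in *.
assert (Ht : 0 <= t) by apply pow2_ge_0.
assert (A2 : Cmod (a 2%nat) ^ 2 = B1 ^ 2 * t / 4).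
{ apply (f_equal (fun x => Cmod x ^ 2)) in E2; rewrite !Cmod_mult, !Cmod_R in E2.
  rewrite !Rpow_mult_distr, <- !Rsqr_pow2, <- !Rsqr_abs, !Rsqr_pow2 in E2; fold t in E2; lra. }
assert (A3 : Cmod (a 3%nat - a 2%nat ^ 2) <= (B1 * (1 - t) + (B1 ^ 2 / 2 - B2) * t) / 6).
{ assert (E : (6 * (a 3%nat - a 2%nat ^ 2))%C =
    (B1 * c 2%nat + - (RtoC (B1 ^ 2 / 2 - B2) * c 1%nat ^ 2))%C).
  { replace (6 * (a 3%nat - a 2%nat ^ 2))%C with (6 * a 3%nat - 3 / 2 * (2 * a 2%nat) ^ 2)%C
      by (field; apply RtoC_neq_0; lra).
    rewrite E2, E3; unfold Rdiv; rewrite RtoC_minus, RtoC_mult, RtoC_inv, RtoC_pow by lra.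
    field; apply RtoC_neq_0; lra. }
  apply (f_equal Cmod) in E; rewrite Cmod_mult, Cmod_R, Rabs_pos_eq in E by lra.
  assert (T := Cmod_triangle (B1 * c 2%nat) (- (RtoC (B1 ^ 2 / 2 - B2) * c 1%nat ^ 2))).
  rewrite <- E, Cmod_opp, !Cmod_mult, Cmod_pow, !Cmod_R, !Rabs_pos_eq in T by lra.
  fold t in T; nra. }
rewrite A2; unfold det_profile.
assert (S3 : Cmod (a 3%nat - a 2%nat ^ 2) ^ 2 <=
  ((B1 * (1 - t) + (B1 ^ 2 / 2 - B2) * t) / 6) ^ 2)
  by (apply pow_incr; split; [apply Cmod_ge_0|exact A3]).
nra.
Qed.

(** The profile is a quadratic polynomial in [t] with leading coefficient [den / 36],
    negative slope at [0] and, when [den <> 0], its vertex at [sigma / 4].  On [0, 1] it is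
    therefore concave, or decreasing, or minimal at the vertex; its values at [0] and [1]
    are [1 - B1 ^ 2 / 36] and [bound_z]. *)
Lemma det_profile_min (B1 B2 t : R) :
  0 < B1 -> 2 * B2 <= B1 ^ 2 -> 0 <= t <= 1 ->
  let den := 2 * B1 ^ 4 + B1 ^ 3 - B1 ^ 2 - 2 * B1 * B2 + B1 ^ 2 * B2 - B2 ^ 2 in
  let sigma := 2 * B1 * (B1 ^ 2 + 16 * B1 - 2 * B2) / den in
  let bound_z := 1 - B1 ^ 2 / 2 + B1 ^ 4 / 18 + B1 ^ 2 * B2 / 36 - B2 ^ 2 / 36 in
  (~ (0 <= sigma <= 4) -> Rmin (1 - B1 ^ 2 / 36) bound_z <= det_profile B1 B2 t) /\
  (sigma = 4 -> bound_z <= det_profile B1 B2 t) /\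
  (0 < sigma < 4 ->
     1 - B1 ^ 3 * (B1 ^ 3 + 4 * B1 ^ 2 + 28 * B1 - 8 * B2) / (16 * den) <= det_profile B1 B2 t).
Proof.
intros HB1 HB2 Ht den sigma bound_z.
set (N := B1 * (B1 ^ 2 + 16 * B1 - 2 * B2)).
assert (HN : 0 < N) by (unfold N; nra).
assert (P : det_profile B1 B2 t = 1 - B1 ^ 2 / 36 - N * t / 36 + den * t ^ 2 / 36)
  by (unfold det_profile, N, den; field).
assert (Z : bound_z = 1 - B1 ^ 2 / 36 - N / 36 + den / 36)
  by (unfold bound_z, N, den; field).
(* Division by zero yields [0], so a vanishing [den] makes [sigma = 4] and [0 < sigma]
   impossible. *)
assert (S0 : den = 0 -> sigma = 0)
  by (intros H; unfold sigma, Rdiv; rewrite H, Rinv_0; ring).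
assert (SN : den <> 0 -> sigma * den = 2 * N)
  by (intros H; unfold sigma, N; field; exact H).
assert (decr : 2 * den <= N -> bound_z <= det_profile B1 B2 t).
{ intros H; rewrite P, Z.
  assert (0 <= (1 - t) * (N - den * (1 + t))) by (apply Rmult_le_pos; nra).
  nra. }
repeat split.
- intros Hs; destruct (Rle_lt_dec den 0) as [Hd|Hd].
  + assert (0 <= - den * (t * (1 - t))) by (apply Rmult_le_pos; nra).
    assert (M1 := Rmin_l (1 - B1 ^ 2 / 36) bound_z).
    assert (M2 := Rmin_r (1 - B1 ^ 2 / 36) bound_z).
    set (m := Rmin _ _) in *.
    apply Rle_trans with ((1 - t) * (1 - B1 ^ 2 / 36) + t * bound_z); [nra|].
    rewrite P, Z; nra.
  + eapply Rle_trans; [apply Rmin_r|]; apply decr.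
    assert (E := SN ltac:(lra)).
    assert (4 < sigma); [|nra].
    apply Rnot_le_lt; intros H; apply Hs; split; [|exact H].
    apply Rmult_le_reg_r with den; lra.
- intros Hs; apply decr.
  assert (Hd : den <> 0) by (intros H; apply S0 in H; lra).
  assert (E := SN Hd); rewrite Hs in E; lra.
- intros [Hs0 Hs4].
  assert (Hd : den <> 0) by (intros H; apply S0 in H; lra).
  assert (E := SN Hd).
  assert (Hd0 : 0 < den) by nra.
  rewrite P.
  replace (1 - B1 ^ 3 * _ / _) with (1 - B1 ^ 2 / 36 - N ^ 2 / (144 * den)).
  2: { unfold N; cut (den = 2 * B1 ^ 4 + B1 ^ 3 - B1 ^ 2 - 2 * B1 * B2 + B1 ^ 2 * B2 - B2 ^ 2); [|reflexivity].
       clearbody den; intros Hden.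
       apply Rmult_eq_reg_r with (144 * den); [|lra]; field_simplify; [|lra|lra].
       rewrite Hden; field. }
  apply Rmult_le_reg_r with (144 * den); [lra|].
  replace ((1 - B1 ^ 2 / 36 - N ^ 2 / (144 * den)) * (144 * den))
    with ((1 - B1 ^ 2 / 36) * (144 * den) - N ^ 2) by (field; lra).
  assert (0 <= (2 * den * t - N) ^ 2) by apply pow2_ge_0.
  nra.
Qed.

(** The extremal functions: [z ^ k] serves as the Schwarz function in the definition of the
    class, with [c 1 = 1] for [k = 1] and [c 2 = 1] for [k = 2]. *)
Lemma class_C_extremal (phi : C -> C) (B : nat -> R) (k : nat) (b : nat -> C) :
  expansion phi (fun n => RtoC (B n)) -> B 0%nat = 1 -> (0 < k)%nat ->
  expansion (fun z => phi (z ^ k)%C) b -> b 0%nat = RtoC 1 ->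
  let d n := if (n =? k)%nat then RtoC 1 else RtoC 0 in
  exists f a, class_C phi f /\ expansion f a /\ a 1%nat = RtoC 1 /\
    (2 * a 2%nat = B 1%nat * d 1%nat)%C /\
    (6 * a 3%nat = B 1%nat * d 2%nat + B 2%nat * d 1%nat ^ 2 + (B 1%nat * d 1%nat) ^ 2)%C.
Proof.
intros hB B0 Hk Hb b0 d.
destruct (convex_of_expansion _ b Hb b0) as [f [a [Ha [a0 [a1 [Hne Heq]]]]]].
assert (Hw : expansion (fun z => z ^ k)%C d) by apply expansion_monomial.
assert (self : forall z, in_disc z -> in_disc (z ^ k)%C).
{ unfold in_disc; intros z Hz; rewrite Cmod_pow; destruct k as [|k]; [lia|].
  assert (H0 := Cmod_ge_0 z).
  assert (Cmod z ^ k <= 1) by (rewrite <- (pow1 k); apply pow_incr; lra).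
  assert (0 <= Cmod z ^ k) by now apply pow_le.
  simpl; nra. }
exists f, a; split; [|split; [exact Ha|split; [exact a1|]]].
- split; [now exists a|split; [exact Hne|]].
  exists (fun z => z ^ k)%C; split; [eexists; exact Hw|split; [exact self|split; [|exact Heq]]].
  destruct k as [|k]; [lia|]; rewrite Cpow_S; ring.
- apply (convex_coef phi f (fun z => z ^ k)%C a d B hB B0 Ha a1 Hne Hw); [|exact self|exact Heq].
  unfold d; destruct k as [|k]; [lia|reflexivity].
Qed.

Theorem theorem5 (phi : C -> C) (B : nat -> R)
  (hphi : ma_minda phi)
  (hB : expansion phi (fun n => RtoC (B n)))
  (hB12 : B 1%nat ^ 2 >= 2 * B 2%nat) :
  let B1 := B 1%nat in
  let B2 := B 2%nat in
  let den := 2 * B1 ^ 4 + B1 ^ 3 - B1 ^ 2 - 2 * B1 * B2 + B1 ^ 2 * B2 - B2 ^ 2 in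
  let sigma := 2 * B1 * (B1 ^ 2 + 16 * B1 - 2 * B2) / den in
  let bound_z := 1 - B1 ^ 2 / 2 + B1 ^ 4 / 18 + B1 ^ 2 * B2 / 36 - B2 ^ 2 / 36 in
  let bound_min := Rmin (1 - B1 ^ 2 / 36) bound_z in
  (forall (f : C -> C) (a : nat -> C), class_C phi f -> expansion f a ->
     (~ (0 <= sigma <= 4) -> det_T31 a >= bound_min) /\
     (sigma = 4 -> det_T31 a >= bound_z) /\
     (0 < sigma < 4 ->
        det_T31 a >=
        1 - B1 ^ 3 * (B1 ^ 3 + 4 * B1 ^ 2 + 28 * B1 - 8 * B2) / (16 * den))) /\
  (* sharpness of the first two bounds *)
  (~ (0 <= sigma <= 4) ->
     exists (f : C -> C) (a : nat -> C),
       class_C phi f /\ expansion f a /\ det_T31 a = bound_min) /\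
  (sigma = 4 ->
     exists (f : C -> C) (a : nat -> C),
       class_C phi f /\ expansion f a /\ det_T31 a = bound_z).
Proof.
intros B1 B2 den sigma bound_z bound_min.
assert (B0 : B 0%nat = 1).
{ apply RtoC_inj; rewrite <- (expansion_at_0 _ _ hB); apply (mm_at0 phi hphi). }
assert (HB1 : 0 < B1).
{ destruct (mm_deriv0 phi hphi) as [_ H].
  rewrite (expansion_at_0 _ _ (expansion_C_derive _ _ hB)) in H.
  unfold derive_coef in H; simpl in H; unfold B1; lra. }
assert (HB2 : 2 * B2 <= B1 ^ 2) by (apply Rge_le, hB12).
assert (sharp_z : exists f a, class_C phi f /\ expansion f a /\ det_T31 a = bound_z).
{ destruct (class_C_extremal phi B 1%nat (fun n => RtoC (B n)) hB B0 (le_n _))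
    as [f [a [Hf [Ha [a1 [E2 E3]]]]]]; [|now rewrite B0|].
  { apply expansion_ext with (3 := hB); [|reflexivity]; intros z _; now rewrite Cpow_1_r. }
  exists f, a; split; [exact Hf|split; [exact Ha|]].
  rewrite det_T31_squares by exact a1.
  assert (A2 : a 2%nat = RtoC (B1 / 2)).
  { replace (a 2%nat) with (/ 2 * (2 * a 2%nat))%C by (field; apply RtoC_neq_0; lra).
    rewrite E2; fold B1; simpl; unfold Rdiv; rewrite RtoC_mult, RtoC_inv by lra; ring. }
  assert (A3 : a 3%nat = RtoC ((B2 + B1 ^ 2) / 6)).
  { replace (a 3%nat) with (/ 6 * (6 * a 3%nat))%C by (field; apply RtoC_neq_0; lra).
    rewrite E3; fold B1; fold B2; unfold Rdiv; rewrite RtoC_mult, RtoC_inv, RtoC_plus, RtoC_pow by lra; simpl; ring. }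
  rewrite A2, A3, <- RtoC_pow, <- RtoC_minus, !Cmod_R, <- !Rsqr_pow2, <- !Rsqr_abs.
  unfold Rsqr, bound_z; field. }
assert (sharp_0 : exists f a, class_C phi f /\ expansion f a /\ det_T31 a = 1 - B1 ^ 2 / 36).
{ destruct (class_C_extremal phi B 2%nat _ hB B0 ltac:(lia) (expansion_comp_square _ _ hB))
    as [f [a [Hf [Ha [a1 [E2 E3]]]]]]; [simpl; now rewrite B0|].
  exists f, a; split; [exact Hf|split; [exact Ha|]].
  rewrite det_T31_squares by exact a1.
  assert (A2 : a 2%nat = RtoC 0).
  { replace (a 2%nat) with (/ 2 * (2 * a 2%nat))%C by (field; apply RtoC_neq_0; lra).
    rewrite E2; simpl; ring. }
  assert (A3 : a 3%nat = RtoC (B1 / 6)).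
  { replace (a 3%nat) with (/ 6 * (6 * a 3%nat))%C by (field; apply RtoC_neq_0; lra).
    rewrite E3; fold B1; fold B2; unfold Rdiv; rewrite RtoC_mult, RtoC_inv by lra; simpl; ring. }
  rewrite A2, A3, <- RtoC_pow, <- RtoC_minus, !Cmod_R, <- !Rsqr_pow2, <- !Rsqr_abs.
  unfold Rsqr; field. }
split; [|split].
- intros f a [[a' [Ha' [_ Ha1]]] [Hne [w [[c Hc] [Hw [Hw0 Heq]]]]]] Ha.
  assert (c0 : c 0%nat = RtoC 0) by (rewrite <- Hw0; symmetry; now apply expansion_at_0).
  assert (a1 : a 1%nat = RtoC 1).
  { rewrite <- Ha1.
    apply (jet2_unique f _ _ _ _ _ _ (expansion_jet2 f a Ha) (expansion_jet2 f a' Ha')). }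
  destruct (convex_coef phi f w a c B hB B0 Ha a1 Hne Hc c0 Hw Heq) as [E2 E3].
  assert (S := Schwarz_coef_le w c Hc (fun z Hz => Rlt_le _ _ (Hw z Hz)) c0).
  assert (L := det_T31_ge a c B1 B2 HB1 HB2 a1 E2 E3 S).
  assert (Ht : 0 <= Cmod (c 1%nat) ^ 2 <= 1).
  { split; [apply pow2_ge_0|]; assert (H := Cmod_ge_0 (c 2%nat)); lra. }
  destruct (det_profile_min B1 B2 _ HB1 HB2 Ht) as [M1 [M2 M3]].
  split; [|split]; intros Hs; apply Rle_ge; eapply Rle_trans; [|exact L| |exact L| |exact L].
  + now apply M1.
  + now apply M2.
  + now apply M3.
- intros _; unfold bound_min, Rmin; destruct (Rle_dec _ _); [exact sharp_0|exact sharp_z].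
- intros _; exact sharp_z.
Qed.
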